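(* Let $X=\{x_1,\dots,x_n\}$ be a finite metric space and let $Z:=X\sqcup\{x_1\}^{m_1}\sqcup\dots\sqcup\{x_n\}^{m_n}$, where each $m_j\ge0$ is the multiplicity of the extra copies of $x_j$ in $Z$; write $\vec m=(m_1,\dots,m_n)$. Then, for any degree $k\ge 0$, $$\mathcal{B}_{\mathrm{Ver},k}(Z)=\mathcal{B}_{\mathrm{Ver},k}(X)\sqcup\bigsqcup_{\substack{1\le p\le k+1\\ 1\le i_1<\dots<i_p\le n}}\left\{\operatorname{diam}(\{x_{i_1},x_{i_2},\dots,x_{i_p}\})\cdot(1,1)\right\}^{\mu_k(\vec m(I_p))},$$ where $I_p=[i_1,\dots,i_p]$. In particular, for each $j$, the multiplicity of the term $\operatorname{diam}(\{x_j\})\cdot(1,1)$ (the one indexed by $p=1$, $i_1=j$) is $\binom{m_j}{k+1}$.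
   Context: Fix a field $\mathbb{F}$. All unions $\sqcup$ are multiset unions (multiplicities add); $r\cdot(1,1)=(r,r)$; $\{x\}^m$ is the multiset of $m$ copies of $x$. The multiset $Z$ is regarded as a pseudo-metric space with $n+m_1+\dots+m_n$ distinct points: each added copy of $x_j$ is a new point, with distances those of the corresponding points of $X$. Multiplicity function. For $I_p=[i_1,\dots,i_p]$ with $1\le i_1<\dots<i_p\le n$ and $p\le k+1$, put $\vec m(I_p)=(m_{i_1},\dots,m_{i_p})$ and $$\mu_k(\vec m(I_p))=\sum_{q=1}^p\ \sum_{\substack{\omega_1,\dots,\omega_q\ge1\\ \omega_1+\dots+\omega_q+(p-q)=k+1}}\binom{m_{i_1}+1}{\omega_1}\binom{m_{i_2}+1}{\omega_2}\cdots\binom{m_{i_{q-1}}+1}{\omega_{q-1}}\binom{m_{i_q}}{\omega_q}.$$ Vietoris–Rips FCC. For a finite pseudo-metric space $(X,d_X)$, $C_*(\mathrm{VR}(X))$ is the simplicial chain complex over $\mathbb{F}$ of the full simplex on the vertex set $X$ (points at distance $0$ remain distinct vertices), with filtration function $\ell^X(\sum\lambda_i\sigma_i)=\max_{\lambda_i\ne0}\operatorname{diam}(\sigma_i)$ (distinct simplices $\sigma_i$), $\ell^X(0)=-\infty$. Elements $x_1,\dots,x_r$ of the complex are orthogonal if $\ell^X(\sum\lambda_ix_i)=\max_{\lambda_i\ne0}\ell^X(x_i)$ for all scalars. Verbose barcode. For $k\ge0$, choose orthogonal ordered bases $(y_1,\dots,y_a)$ of $C_{k+1}$ and $(w_1,\dots,w_b)$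 of $\ker\partial_k$ such that, with $r=\operatorname{rank}\partial_{k+1}$, $(y_{r+1},\dots,y_a)$ is a basis of $\ker\partial_{k+1}$, $(w_1,\dots,w_r)$ is a basis of $\operatorname{im}\partial_{k+1}$, and $\partial_{k+1}y_i=w_i$ for $i\le r$. The degree-$k$ verbose barcode $\mathcal{B}_{\mathrm{Ver},k}(X)$ is the multiset of pairs $(\ell^X(w_i),\ell^X(y_i))$, $i\le r$, and $(\ell^X(w_i),\infty)$, $r<i\le b$. It does not depend on the choices. *)

(* Defs.v *)
From HB Require Import structures.
From mathcomp Require Import all_boot all_order all_algebra.
From mathcomp Require Import finmap multiset.
From mathcomp Require Import boolp classical_sets reals constructive_ereal.

Set Implicit Arguments.
Unset Strict Implicit.
Unset Printing Implicit Defensive.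

Import Order.TTheory GRing.Theory Num.Theory.

Local Open Scope ring_scope.

(* Nonnegativity of the distance follows from the three axioms. *)
Record finPMetric (R : realType) := FinPMetric {
  pt :> finType;
  pdist : pt -> pt -> R;
  pdistxx : forall a, pdist a a = 0;
  pdist_sym : forall a b, pdist a b = pdist b a;
  pdist_triangle : forall b a c, pdist a c <= pdist a b + pdist b c
}.

Definition is_metric (R : realType) (X : finPMetric R) : Prop :=
  forall a b : X, pdist a b = 0 -> a = b.

Section AddCopies.
Variables (R : realType) (X : finPMetric R) (n : nat) (x : 'I_n -> X).
Variable m : 'I_n -> nat.

(* [inr (Tagged _ c)] with [c : 'I_(m j)] is the [c]-th added copy of [x j]. *)
Definition copies_pt : finType := (X + {j : 'I_n & 'I_(m j)})%type.

Definition copies_proj (z : copies_pt) : X :=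
  match z with inl a => a | inr u => x (tag u) end.

Definition copies_dist (z z' : copies_pt) : R :=
  pdist (copies_proj z) (copies_proj z').

Lemma copies_distxx z : copies_dist z z = 0.
Proof. exact: pdistxx. Qed.

Lemma copies_dist_sym z z' : copies_dist z z' = copies_dist z' z.
Proof. exact: pdist_sym. Qed.

Lemma copies_dist_triangle z' z z'' :
  copies_dist z z'' <= copies_dist z z' + copies_dist z' z''.
Proof. exact: pdist_triangle. Qed.

Definition add_copies : finPMetric R :=
  FinPMetric copies_distxx copies_dist_sym copies_dist_triangle.

End AddCopies.

(* The default 0 is harmless on nonempty sets since [pdist a a = 0]. *)
Definition diam (R : realType) (X : finPMetric R) (A : {set X}) : R :=
  \big[Num.max/0]_(a in A) \big[Num.max/0]_(b in A) pdist a b.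

Section FullSimplex.
Variables (F : fieldType) (V : finType).

Definition simplex (k : nat) := {s : {set V} | #|s| == k.+1}.

(* Formal F-linear combinations of k-simplices, as coefficient functions. *)
Definition chain (k : nat) := {ffun simplex k -> F^o}.

(* Simplices are oriented by the enumeration order of V; [vpos s v] is the
   index of the vertex v in the ordered simplex s. *)
Definition vpos (s : {set V}) (v : V) : nat :=
  #|[set u in s | (enum_rank u < enum_rank v)%N]|.

(* The coefficient of t in the boundary of s. *)
Definition incidence (s t : {set V}) : F :=
  \sum_(v in s | s :\ v == t) (-1) ^+ vpos s v.

Definition boundary_fun (k : nat) (c : chain k.+1) : chain k :=
  [ffun t => \sum_s c s * incidence (val s) (val t)].

Lemma boundary_fun_is_linear k : linear (@boundary_fun k).
Proof.
move=> a c c'; apply/ffunP => t; rewrite !ffunE /= scaler_sumr -big_split /=.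
by apply: eq_bigr => s _; rewrite !ffunE /= mulrDl scalerAl.
Qed.

HB.instance Definition _ k :=
  GRing.isLinear.Build F (chain k.+1) (chain k) _ (@boundary_fun k)
    (@boundary_fun_is_linear k).

(* [boundary k] goes from degree k.+1 to degree k. *)
Definition boundary (k : nat) : 'Hom(chain k.+1, chain k) :=
  linfun (@boundary_fun k).

(* The complex is not augmented: the boundary vanishes in degree 0. *)
Definition cycles (k : nat) : {vspace chain k} :=
  match k with
  | 0 => fullv
  | k'.+1 => lker (boundary k')
  end.

End FullSimplex.

Section VerboseBarcode.
Variables (F : fieldType) (R : realType) (X : finPMetric R).

Definition filt (k : nat) (c : chain F X k) : \bar R :=
  \big[maxe/-oo%E]_(s | c s != 0) (diam (val s))%:E.

Definition orthogonal (k : nat) (e : seq (chain F X k)) : Prop :=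
  forall lam : 'I_(size e) -> F,
    filt (\sum_i lam i *: e`_i) =
    \big[maxe/-oo%E]_(i | lam i != 0) filt e`_i.

(* Adapted bases: y of the (k+1)-chains and w of the k-cycles. *)
Definition adapted_bases (k : nat)
    (y : seq (chain F X k.+1)) (w : seq (chain F X k)) : Prop :=
  let r := \dim (limg (boundary F X k)) in
  [/\ orthogonal y /\ orthogonal w,
      basis_of fullv y /\ basis_of (cycles F X k) w,
      basis_of (lker (boundary F X k)) (drop r y),
      basis_of (limg (boundary F X k)) (take r w) &
      forall i, (i < r)%N -> boundary F X k y`_i = w`_i].

Definition bars (k : nat) (y : seq (chain F X k.+1)) (w : seq (chain F X k)) :
    {mset \bar R * \bar R}%mset :=
  seq_mset
    [seq (filt w`_i, if (i < \dim (limg (boundary F X k)))%N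
                     then filt y`_i else +oo%E) | i <- iota 0 (size w)].

Definition is_verbose_barcode (k : nat) (B : {mset \bar R * \bar R}%mset) :
    Prop :=
  exists y w, @adapted_bases k y w /\ B = bars y w.

(* Exactly one multiset satisfies [is_verbose_barcode k], so [xget] selects it
   and its default value is never used. *)
Definition verbose_barcode (k : nat) : {mset \bar R * \bar R}%mset :=
  xget mset0 [set B | is_verbose_barcode k B]%classic.

End VerboseBarcode.

(* [m] lists m_{i_1}, ..., m_{i_p}, so p = size m and m_{i_{j+1}} is
   [nth 0 m j]. The constraint bounds each omega_j by k+1, hence the finite
   type ['I_k.+2] for its values. *)
Definition mu (k : nat) (m : seq nat) : nat :=
  (\sum_(1 <= q < (size m).+1)
     \sum_(w : {ffun 'I_q -> 'I_k.+2} |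
             [forall j, 0 < w j] &&
             (\sum_(j < q) w j + (size m - q) == k.+1))
       \prod_(j < q)
         (if j.+1 == q then 'C(nth 0 m j, w j) else 'C((nth 0 m j).+1, w j)))%N.

(* Main.v *)
Require Import Defs.
From HB Require Import structures.
From mathcomp Require Import all_boot all_order all_algebra.
From mathcomp Require Import finmap multiset.
From mathcomp Require Import ring.
From mathcomp Require Import boolp reals constructive_ereal.

(** The chains of [VR(Z)] are realised inside the exterior algebra on [Z].
    For a copy [z] of [y], the homotopy [c |-> y /\ z /\ (z _| c)] preserves
    diameters and shows that sliding [z] onto [y] is chain homotopic to the
    identity in every sublevel.  Sliding all copies gives a filtered retraction
    of [C(Z)] onto [C(X)] whose kernel [K] is acyclic in every sublevel.

    A verbose barcode is determined by the numbers of bars [(a, b)] with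
    [a <= s] and [b <= t], which are dimensions of cycles of filtration at most
    [s], or of such cycles that bound in filtration [t].  By the
    retraction these dimensions split into those of [X] and those of [K], and
    acyclicity makes the latter depend only on [min s t]: the extra bars are
    diagonal, and they are counted by the cycles [z_k] of [K].  As
    [z_(k+1) + z_k = dim K_(k+1)] counts the simplices of [Z] that are not in
    [X], grouping simplices by their image in [X] reduces the theorem to the
    identity [(1 + T) sum_k mu_k T^(k+1) = prod_j ((1 + T)^(m_j + 1) - 1) - T^p]. *)

Set Implicit Arguments.
Unset Strict Implicit.
Unset Printing Implicit Defensive.

Import Order.TTheory GRing.Theory Num.Theory.

Local Open Scope ring_scope.

(** * Exterior algebra and the slide homotopy *)

Section ExteriorAlgebra.
Variables (F : fieldType) (V : finType).
Local Notation E := {ffun {set V} -> F^o}.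

(** The sign of moving [v] past the smaller vertices of [t], that is, of sorting the wedge product
    of [v] and [t]. *)
Definition vsgn (v : V) (t : {set V}) : F := (-1) ^+ vpos t v.

Lemma vposU1 (v : V) (t : {set V}) : vpos (v |: t) v = vpos t v.
Proof.
apply: eq_card => u; rewrite !inE.
by case: (eqVneq u v) => [->|//]; rewrite ltnn !andbF.
Qed.

Lemma vposU (u v : V) (t : {set V}) : v \notin t ->
  vpos (v |: t) u = (vpos t u + (enum_rank v < enum_rank u))%N.
Proof.
move=> vt; case vu: (enum_rank v < enum_rank u)%N; rewrite /vpos /=.
  rewrite (cardsD1 v) !inE eqxx vu /= addnC; congr (_ + _)%N.
  apply: eq_card => w; rewrite !inE.
  by case: (eqVneq w v) => [->|//]; rewrite (negbTE vt).
rewrite addn0; apply: eq_card => w; rewrite !inE.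
by case: (eqVneq w v) => [->|//]; rewrite vu !andbF.
Qed.

Lemma vsgn_sq (v : V) (t : {set V}) : vsgn v t * vsgn v t = 1.
Proof. by rewrite /vsgn -expr2 sqrr_sign. Qed.

Lemma vsgnU1 (v : V) (t : {set V}) : vsgn v (v |: t) = vsgn v t.
Proof. by rewrite /vsgn vposU1. Qed.

Lemma vsgnD1 (v : V) (t : {set V}) : vsgn v (t :\ v) = vsgn v t.
Proof. 
rewrite -[LHS]vsgnU1 -[RHS]vsgnU1; congr (vsgn v _).
by apply/setP => w; rewrite !inE; case: eqP.
 Qed.

(** Exactly one of [u], [v] precedes the other, so exactly one of the two insertions shifts the
    position of the other vertex. *)
Lemma vsgnC (u v : V) (t : {set V}) : u != v -> u \notin t -> v \notin t ->
  vsgn u t * vsgn v (u |: t) = - (vsgn v t * vsgn u (v |: t)).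
Proof.
move=> uv ut vt; rewrite /vsgn !vposU // !exprD.
have : (enum_rank u < enum_rank v)%N = ~~ (enum_rank v < enum_rank u)%N.
  rewrite -leqNgt ltn_neqAle -[X in X && _]/(enum_rank u != enum_rank v).
  by rewrite (inj_eq enum_rank_inj) uv.
move=> ->; case: (ltnP (enum_rank v) (enum_rank u)) => _ /=;
  by rewrite expr0 expr1 !mulr1 mulrN1 !mulrN ?opprK mulrC.
Qed.

(** [ins v] is left exterior multiplication by [v], and [del v] is the contraction with the dual of
    [v]. Sets of all sizes, the empty one included, index the basis, which avoids degree indices. *)
Definition ins (v : V) (c : E) : E :=
  [ffun t : {set V} => (if v \in t then vsgn v t * c (t :\ v) else 0) : F^o].

Definition del (v : V) (c : E) : E :=
  [ffun t : {set V} => (if v \in t then 0 else vsgn v t * c (v |: t)) : F^o].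

Lemma ins_is_linear v : linear (ins v).
Proof.
move=> a c c'; apply/ffunP => t; rewrite !ffunE.
by case: ifP => _; rewrite ?scaler0 ?addr0 // mulrDr scalerAr.
Qed.
HB.instance Definition _ v := GRing.isLinear.Build F E E _ (ins v) (ins_is_linear v).

Lemma del_is_linear v : linear (del v).
Proof.
move=> a c c'; apply/ffunP => t; rewrite !ffunE.
by case: ifP => _; rewrite ?scaler0 ?addr0 // mulrDr scalerAr.
Qed.
HB.instance Definition _ v := GRing.isLinear.Build F E E _ (del v) (del_is_linear v).

Lemma ins_del v c t : ins v (del v c) t = if v \in t then c t else 0.
Proof.
rewrite !ffunE; case: ifP => // vt.
by rewrite !inE eqxx /= vsgnD1 mulrA vsgn_sq mul1r setD1K.
Qed.

Lemma del_ins v c t : del v (ins v c) t = if v \in t then 0 else c t.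
Proof.
rewrite !ffunE; case: ifP => // /negbT vt.
by rewrite !inE eqxx /= vsgnU1 mulrA vsgn_sq mul1r setU1K.
Qed.

Lemma del_delC u v c : u != v -> del u (del v c) = - del v (del u c).
Proof.
move=> uv; apply/ffunP => t; rewrite !ffunE !inE (negbTE uv) eq_sym (negbTE uv) /=.
case: ifP => [|/negbT] ut; case: ifP => [|/negbT] vt; rewrite ?mulr0 ?oppr0 //.
by rewrite !mulrA vsgnC // mulNr setUCA.
Qed.

Lemma del_del v c : del v (del v c) = 0.
Proof. by apply/ffunP => t; rewrite !ffunE !inE eqxx /=; case: ifP; rewrite ?mulr0. Qed.

Lemma del_insC u v c : u != v -> del u (ins v c) = - ins v (del u c).
Proof.
move=> uv; apply/ffunP => t; rewrite !ffunE !inE (negbTE uv) eq_sym (negbTE uv) /=.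
case: ifP => [|/negbT] ut; case: ifP => [|/negbT] vt; rewrite ?mulr0 ?oppr0 //.
have uv' : (u |: t) :\ v = u |: (t :\ v).
  by apply/setP => w; rewrite !inE; case: (eqVneq w u) => [->|]; rewrite ?uv ?orbF.
rewrite !mulrA -mulNr uv'; congr (_ * _).
have ut' : u \notin t :\ v by rewrite !inE negb_and ut orbT.
have vt' : v \notin t :\ v by rewrite !inE eqxx.
have := vsgnC uv ut' vt'; rewrite setD1K //.
have -> : vsgn v (u |: t :\ v) = vsgn v (u |: t) by rewrite -uv' vsgnD1.
rewrite vsgnD1 => H.
rewrite -[LHS]mul1r -(vsgn_sq u (t :\ v)) mulrACA [_ * vsgn v _ in LHS]H.
by rewrite mulrN mulrACA [_ * vsgn v t]mulrC vsgn_sq mulr1.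
Qed.

(** Contraction with the linear form equal to 1 on every vertex. *)
Definition bd (c : E) : E := \sum_v del v c.

Lemma bdE c t : bd c t = \sum_(v | v \notin t) vsgn v t * c (v |: t).
Proof.
rewrite /bd sum_ffunE [RHS]big_mkcond /=; apply: eq_bigr => v _.
by rewrite ffunE; case: (v \in t).
Qed.

Lemma bd_is_linear : linear bd.
Proof.
by move=> a c c'; rewrite /bd scaler_sumr -big_split; apply: eq_bigr => v _; rewrite linearP.
Qed.
HB.instance Definition _ := GRing.isLinear.Build F E E _ bd bd_is_linear.

(** Leibniz rule: a contraction is an antiderivation, and this one has value 1 on [v]. *)
Lemma bd_ins v c : bd (ins v c) = c - ins v (bd c).
Proof.
rewrite /bd linear_sum (bigD1 v) //= [in RHS](bigD1 v) //= opprD addrA -sumrN.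
congr (_ + _); last by apply: eq_bigr => u uv; rewrite del_insC.
apply/ffunP => t; rewrite del_ins [RHS]ffunE [X in _ + X]ffunE ins_del.
by case: ifP => _; rewrite ?subrr ?subr0.
Qed.

Lemma bd_del v c : bd (del v c) = - del v (bd c).
Proof.
rewrite /bd linear_sum (bigD1 v) //= [in RHS](bigD1 v) //= del_del !add0r -sumrN.
by apply: eq_bigr => u uv; rewrite del_delC.
Qed.

(** Anticommutation alone shows only that the sum is its own opposite, which says nothing in
    characteristic 2; so each ordered pair is matched with its transpose. *)
Lemma bd_bd c : bd (bd c) = 0.
Proof.
pose lt (u v : V) := (enum_rank u < enum_rank v)%N.
have split u : del u (bd c) = \sum_(v | lt u v) del u (del v c)
                             + \sum_(v | lt v u) del u (del v c).
  rewrite /bd linear_sum (bigD1 u) //= del_del add0r.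
  rewrite (bigID (lt u)) /=; congr (_ + _); apply: eq_bigl => v; rewrite /lt.
    by case: (eqVneq v u) => [->|]; rewrite ?ltnn.
  by rewrite -leqNgt ltn_neqAle -[X in _ = X && _]/(enum_rank v != enum_rank u)
     (inj_eq enum_rank_inj).
rewrite {1}/bd (eq_bigr _ (fun u _ => split u)) big_split /=.
rewrite [X in _ + X](exchange_big_dep xpredT) //= -big_split /= big1 // => u _.
rewrite -big_split big1 // => v uv.
rewrite del_delC; first exact: addNr.
by apply: contraTneq uv => ->; rewrite /lt ltnn.
Qed.

(* [bd] is the augmented boundary; [rbd] drops the augmentation, as [cycles] does. *)
Definition rbd (c : E) : E := [ffun t => if t == set0 then 0 else bd c t].

Lemma rbd_is_linear : linear rbd.
Proof.
move=> a c c'; apply/ffunP => t; rewrite [LHS]ffunE linearP !ffunE.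
by case: ifP => _; rewrite ?scaler0 ?addr0.
Qed.
HB.instance Definition _ := GRing.isLinear.Build F E E _ rbd rbd_is_linear.

Lemma eq_bd (c c' : E) (t : {set V}) : (forall v, v \notin t -> c (v |: t) = c' (v |: t)) -> bd c t = bd c' t.
Proof. by move=> cc'; rewrite !bdE; apply: eq_bigr => v vt; rewrite cc'. Qed.

Lemma rbd_rbd c : rbd (rbd c) = 0.
Proof.
apply/ffunP => t; rewrite [LHS]ffunE [RHS]ffunE; case: ifP => // t0.
rewrite -[RHS](ffunE (fun=> 0) t) -[finfun _]/(0 : E) -(bd_bd c).
apply: eq_bd => v vt; rewrite ffunE; case: eqP => // /setP /(_ v).
by rewrite !inE eqxx.
Qed.

(** * Sliding one vertex onto another *)

Section Slide.
Variables (y z : V).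
Hypothesis yz : y != z.

Definition cone (c : E) : E := ins y (ins z (del z c)).

(** The algebra map that sends [z] to [y] and fixes the other vertices: on [a + z /\ b], with [a]
    and [b] free of [z], it gives [a + y /\ b]. *)
Definition slide (c : E) : E := c - (ins z (del z c) - ins y (del z c)).

Lemma slide_is_linear : linear slide.
Proof.
move=> a c c'; rewrite /slide !linearP scalerBr scalerBr; apply/ffunP => t.
by rewrite !ffunE; ring.
Qed.
HB.instance Definition _ := GRing.isLinear.Build F E E _ slide slide_is_linear.

Lemma coneE c t :
  cone c t = if (y \in t) && (z \in t) then vsgn y t * c (t :\ y) else 0.
Proof.
rewrite ffunE ins_del !inE; case: (y \in t) => //=.
by rewrite eq_sym yz /=; case: ifP; rewrite ?mulr0.
Qed.

Lemma slideE c t : slide c t =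
  if z \in t then 0 else
  c t + (if y \in t then vsgn y t * (vsgn z (t :\ y) * c (z |: (t :\ y))) else 0).
Proof.
rewrite ffunE [X in _ + X]ffunE [X in _ - X]ffunE ins_del [X in _ - (_ + X)]ffunE ffunE.
rewrite ffunE !inE eq_sym yz /=.
by case: (z \in t); case: (y \in t);
  rewrite ?mulr0 ?oppr0 ?addr0 ?subr0 ?subrr ?sub0r ?opprK.
Qed.

(** Leibniz twice: [bd] of [y /\ z /\ b] is [z /\ b - y /\ b + y /\ z /\ bd b], and contraction by
    [z] anticommutes with [bd]. *)
Lemma rbd_cone c : rbd (cone c) + cone (rbd c) = c - slide c.
Proof.
(* [cone] reads only coefficients of sets containing [z], so dropping the augmentation changes
   nothing. *)
have -> : cone (rbd c) = cone (bd c).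
  apply/ffunP => t; rewrite !coneE ffunE; case: ifP => // /andP[_ zt].
  by case: eqP => // /setP/(_ z); rewrite !inE eq_sym yz zt.
(* [cone c] has no single-vertex terms, so its boundary vanishes at the empty set. *)
have -> : rbd (cone c) = bd (cone c).
  apply/ffunP => t; rewrite ffunE; case: eqP => // ->.
  rewrite bdE big1 // => v _; rewrite coneE !inE !orbF.
  case: ifP => [/andP[/eqP <- /eqP zy]|_]; last by rewrite mulr0.
  by move: yz; rewrite zy eqxx.
rewrite /cone bd_ins bd_ins bd_del /slide opprB addrCA subrr addr0.
by rewrite linearB /= !linearN /= opprK opprD addrA subrK.
Qed.

Lemma rbd_slide c : rbd (slide c) = slide (rbd c).
Proof.
have slide_cone x : slide x = x - (rbd (cone x) + cone (rbd x)) by rewrite rbd_cone subKr.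
rewrite !slide_cone linearB linearD /= rbd_rbd add0r.
by rewrite [cone (rbd (rbd c))]/cone rbd_rbd !linear0 addr0.
Qed.

End Slide.

End ExteriorAlgebra.

(** * Coordinate subspaces *)

Section Coordinates.
Variables (F : fieldType) (vT : vectType F).

(** Serves both for chains supported on a set of simplices and, in adapted bases, for the spaces
    behind the rank function: each is a coordinate subspace. *)
Lemma dim_coords (I : finType) (P : pred I) (e : I -> vT) (A : {vspace vT}) :
  (forall lam : I -> F, \sum_i lam i *: e i = 0 -> forall i, lam i = 0) ->
  (forall v, v \in A <->
     exists2 lam : I -> F, v = \sum_i lam i *: e i & forall i, ~~ P i -> lam i = 0) ->
  \dim A = #|P|.
Proof.
move=> fr memA.
have -> : A = (\sum_(i | P i) <[e i]>)%VS.
  apply/vspaceP => v; apply/idP/idP.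
    move/memA => [lam -> lam0]; rewrite (bigID P) /= [X in _ + X]big1 ?addr0.
      by apply: memv_sumr => i _; apply: memvZ; apply: memv_line.
    by move=> i /lam0 ->; rewrite scale0r.
  move=> /memv_sumP [vs vsP ->]; apply/memA.
  have {}vsP i : exists l, P i -> vs i = l *: e i.
    case Pi: (P i); last by exists 0.
    by have /vlineP[l ->] := vsP i Pi; exists l.
  have [lam lamP] := choice vsP.
  exists (fun i => if P i then lam i else 0) => [|i /negbTE -> //].
  rewrite [LHS]big_mkcond; apply: eq_bigr => i _ /=.
  by case: ifP => [/lamP //|]; rewrite scale0r.
have /directvP -> /= : directv (\sum_(i | P i) <[e i]>)%VS.
  apply/directv_sum_independent => us usP us0 i Pi.
  have {}usP j : exists l, P j -> us j = l *: e j.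
    case Pj: (P j); last by exists 0.
    by have /vlineP[l ->] := usP j Pj; exists l.
  have [lam lamP] := choice usP.
  have /fr/(_ i) : \sum_i (if P i then lam i else 0) *: e i = 0.
    rewrite -[RHS]us0 [RHS]big_mkcond; apply: eq_bigr => j _ /=.
    by case: ifP => [/lamP //|]; rewrite scale0r.
  by rewrite Pi lamP // => ->; rewrite scale0r.
rewrite -sum1_card; apply: eq_bigr => i _; rewrite dim_vline.
case: eqP => // ei0.
have /fr/(_ i) : \sum_j (if j == i then 1 else 0) *: e j = 0.
  rewrite big1 // => j _; case: eqP => [->|]; by rewrite ?ei0 ?scaler0 ?scale0r.
by rewrite eqxx => /eqP; rewrite oner_eq0.
Qed.

End Coordinates.

Section Supports.
Variables (F : fieldType) (T : finType).
Local Notation E := {ffun T -> F^o}.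

Definition restr (P : pred T) (c : E) : E := [ffun t => if P t then c t else 0].

Lemma restr_is_linear P : linear (restr P).
Proof.
move=> a c c'; apply/ffunP => t; rewrite !ffunE.
by case: ifP => _; rewrite ?scaler0 ?addr0.
Qed.
HB.instance Definition _ P := GRing.isLinear.Build F E E _ (restr P) (restr_is_linear P).

Definition suppv (P : pred T) : {vspace E} := lker (linfun (restr (predC P))).

Lemma suppvP (P : pred T) (c : E) :
  reflect (forall t, ~~ P t -> c t = 0) (c \in suppv P).
Proof.
rewrite memv_ker lfunE /=; apply: (iffP eqP) => [/ffunP c0 t Pt|c0].
  by have := c0 t; rewrite !ffunE /= Pt.
by apply/ffunP => t; rewrite !ffunE /=; case: ifP => // /c0.
Qed.

Lemma dim_suppv (P : pred T) : \dim (suppv P) = #|P|.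
Proof.
pose e (s : T) : E := [ffun t => (s == t)%:R : F^o].
have sumE (lam : T -> F) t : (\sum_i lam i *: e i) t = lam t.
  rewrite sum_ffunE (bigD1 t) //= big1 ?addr0 => [|s st]; rewrite !ffunE.
    by rewrite eqxx [LHS]mulr1.
  by rewrite (negbTE st) [LHS]mulr0.
apply: (dim_coords (e := e)) => [lam l0 i|c]; first by rewrite -sumE l0 ffunE.
split=> [/suppvP c0|[lam -> lam0]].
  by exists (fun t => c t) => //; apply/ffunP => t; rewrite sumE.
by apply/suppvP => t /lam0; rewrite sumE.
Qed.

Lemma suppv_cap (P Q : pred T) : (suppv P :&: suppv Q)%VS = suppv (predI P Q).
Proof.
apply/vspaceP => c; rewrite memv_cap; apply/andP/suppvP => [[/suppvP cP /suppvP cQ] t|cPQ].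
  by rewrite negb_and => /orP[/cP|/cQ].
by split; apply/suppvP => t nt; apply: cPQ; rewrite negb_and nt ?orbT.
Qed.

Lemma eq_suppv (P Q : pred T) : P =1 Q -> suppv P = suppv Q.
Proof.
move=> PQ; apply/vspaceP => c; apply/suppvP/suppvP => c0 t; have := PQ t; have := c0 t.
  by move=> + <-.
by move=> + ->.
Qed.

End Supports.

(** * Filtered retraction onto the original points *)

Section Diameter.
Variables (R : realType) (X : finPMetric R).

Lemma diam_ge0 (A : {set X}) : 0 <= diam A.
Proof. exact: bigmax_ge_id. Qed.

Lemma diam_leP (A : {set X}) u : 0 <= u ->
  reflect (forall a b, a \in A -> b \in A -> pdist a b <= u) (diam A <= u).
Proof.
move=> u0; apply: (iffP (bigmax_leP _ _ _ _)) => [[_ H] a b aA bA|H].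
  by have /bigmax_leP[_] := H a aA; apply.
split=> // a aA; apply/bigmax_leP; split=> // b; exact: H.
Qed.

End Diameter.

Lemma diam_imset (R : realType) (X Y : finPMetric R) (f : X -> Y) (A : {set X}) :
  (forall a b, pdist (f a) (f b) = pdist a b) -> diam (f @: A) = diam A.
Proof.
move=> fd; apply/eqP; rewrite eq_le; apply/andP; split.
  apply/(diam_leP _ (diam_ge0 _)) => _ _ /imsetP[a aA ->] /imsetP[b bA ->].
  by rewrite fd; have /(diam_leP _ (diam_ge0 _)) := lexx (diam A); apply.
apply/(diam_leP _ (diam_ge0 _)) => a b aA bA; rewrite -fd.
by have /(diam_leP _ (diam_ge0 _)) := lexx (diam (f @: A)); apply; apply: imset_f.
Qed.

Lemma capvAC (F : fieldType) (vT : vectType F) (U V W : {vspace vT}) :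
  (U :&: V :&: W = U :&: W :&: V)%VS.
Proof. by rewrite -!capvA [(V :&: W)%VS]capvC. Qed.

Section Retraction.
Variables (F : fieldType) (R : realType) (Z : finPMetric R) (rho : Z -> Z).
Hypothesis rho_idem : forall z, rho (rho z) = rho z.
Hypothesis rho_dist : forall a b, pdist (rho a) (rho b) = pdist a b.
Local Notation E := {ffun {set Z} -> F^o}.

(** [N] counts vertices, so it is the degree plus one, and the empty simplex appears at [N = 0]. *)
Definition sublevel (N : nat) (s : \bar R) : pred {set Z} :=
  [pred t : {set Z} | (#|t| == N) && ((diam t)%:E <= s)%E].

Definition core : {set Z} := [set z | rho z == z].

Definition in_core : pred {set Z} := [pred t : {set Z} | t \subset core].

Local Notation FS N s := (suppv F (sublevel N s)).

Lemma diam_swap (t t' : {set Z}) : rho @: t = rho @: t' -> diam t = diam t'.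
Proof. by move=> tt'; rewrite -(diam_imset t rho_dist) tt' diam_imset. Qed.

Section OnePoint.
Variable z : Z.
Hypothesis zN : rho z != z.

(** If [t] contains [z] and [rho z], removing [rho z] leaves the image of [t] under [rho] unchanged,
    hence also the diameter. *)
Lemma cone_filt N s (c : E) : c \in FS N s -> cone (rho z) z c \in FS N.+1 s.
Proof.
move=> /suppvP c0; apply/suppvP => t; rewrite coneE //.
case: ifP => // /andP[yt zt]; rewrite /sublevel /= => tN; rewrite c0 ?mulr0 //=.
apply: contra tN => /andP[tN ts]; rewrite (cardsD1 (rho z)) yt eqSS tN /=.
rewrite (@diam_swap t (t :\ rho z)) //; apply/setP => w.
apply/imsetP/imsetP => -[v vt ->]; last by exists v => //; move: vt; rewrite !inE => /andP[].
have [->|vy] := eqVneq v (rho z); last by exists v; rewrite // !inE vy.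
by exists z; rewrite ?rho_idem // !inE zt eq_sym zN.
Qed.

(** Exchanging [z] for [rho z] does not change the image under [rho]. *)
Lemma slide_filt N s (c : E) : c \in FS N s -> slide (rho z) z c \in FS N s.
Proof.
move=> /suppvP c0; apply/suppvP => t tN; rewrite slideE //.
case: ifP => // /negbT zt; rewrite c0 // add0r; case: ifP => // yt.
rewrite c0 ?mulr0 //; apply: contra tN; rewrite /sublevel /=.
rewrite cardsU1 [#|t|](cardsD1 (rho z)) yt !inE negb_and zt orbT => /andP[-> ts] /=.
rewrite (@diam_swap t (z |: t :\ rho z)) //; apply/setP => w.
apply/imsetP/imsetP => -[v vt ->].
  have [->|vy] := eqVneq v (rho z); first by exists z; rewrite ?rho_idem // !inE eqxx.
  by exists v; rewrite // !inE vy vt orbT.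
move: vt; rewrite !inE => /orP[/eqP ->|/andP[_ vt]]; last by exists v.
by exists (rho z); rewrite ?rho_idem.
Qed.

End OnePoint.

(** A filtered chain projection onto the chains avoiding [L]. The last clause is stated for cycles,
    which is what acyclicity of the kernel in every sublevel requires. *)
Definition retraction_along (L : seq Z) (p : 'End(E)) : Prop :=
  [/\ forall (c : E) (z : Z) (t : {set Z}), z \in L -> z \in t -> p c t = 0,
      forall c : E, (forall z (t : {set Z}), z \in L -> z \in t -> c t = 0) -> p c = c,
      forall c : E, rbd (p c) = p (rbd c),
      forall N s c, c \in FS N s -> p c \in FS N s
    & forall N s c, c \in FS N s -> rbd c = 0 ->
        exists2 h, h \in FS N.+1 s & rbd h = c - p c].

(** Slides are composed one point at a time, and the bounding chains add up. *)
Lemma retraction_along_exists (L : seq Z) :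
  (forall z, z \in L -> rho z != z) -> exists p, retraction_along L p.
Proof.
elim: L => [|z L IH] LN.
  exists \1%VF; split=> [//|c _|c|N s c|N s c _ _]; rewrite ?lfunE //.
  by exists 0; rewrite ?mem0v // linear0 subrr.
have [w wL|p [p0 pid prbd pF phom]] := IH; first by apply: LN; rewrite inE wL orbT.
have zN : rho z != z by apply: LN; rewrite mem_head.
(* Targets of slides are fixed by [rho], hence outside the list: no slide brings back a vertex
   removed before. *)
have rhoL v : rho v \notin z :: L by apply/negP => /LN; rewrite rho_idem eqxx.
have SpE c : (linfun (slide (rho z) z) \o p)%VF c = slide (rho z) z (p c).
  by rewrite comp_lfunE lfunE.
exists (linfun (slide (rho z) z) \o p)%VF; split=> [c w t|c c0|c|N s c cF|N s c cF bc].
- rewrite SpE slideE // inE => /orP[/eqP -> ->//|wL wt].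
  case: ifP => // zt; rewrite (p0 _ w) // add0r; case: ifP => // yt.
  rewrite (p0 _ w) ?mulr0 // !inE wt andbT; apply/orP; right.
  by apply: contraTneq wL => ->; have := rhoL z; rewrite inE negb_or => /andP[].
- have pc : p c = c by apply: pid => w t wL; apply: c0; rewrite inE wL orbT.
  rewrite SpE pc; apply/ffunP => t; rewrite slideE //.
  case: ifP => [zt|zt]; first by rewrite (c0 z) ?mem_head.
  case: ifP => _; rewrite ?addr0 // (c0 z (z |: t :\ rho z)) ?mem_head ?setU11 //.
  by rewrite !mulr0 addr0.
- by rewrite !SpE rbd_slide // prbd.
- by rewrite SpE; apply: slide_filt => //; apply: pF.
have [h hF hb] := phom _ _ _ cF bc.
(* [h] bounds [c - p c], and the cone of the cycle [p c] bounds the change made by the last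
   slide. *)
exists (h + cone (rho z) z (p c)).
  by apply: memvD => //; apply: cone_filt => //; apply: pF.
rewrite linearD /= hb SpE; have := rbd_cone zN (p c); rewrite prbd bc linear0.
by rewrite [cone _ _ 0]/cone !linear0 addr0 => ->; rewrite addrA subrK.
Qed.


Lemma diam_subset (A B : {set Z}) : A \subset B -> diam A <= diam B.
Proof.
move=> /fintype.subsetP AB; apply/(diam_leP _ (diam_ge0 _)) => a b /AB aB /AB bB.
by have /(diam_leP _ (diam_ge0 _)) := lexx (diam B); apply.
Qed.

Lemma rbd_filt N s (c : E) : c \in FS N.+1 s -> rbd c \in FS N s.
Proof.
move=> /suppvP c0; apply/suppvP => t tN; rewrite ffunE; case: ifP => // _.
rewrite bdE big1 // => v vt; rewrite c0 ?mulr0 //; apply: contra tN.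
rewrite /sublevel /= cardsU1 vt eqSS => /andP[-> /=]; apply: le_trans.
by rewrite lee_fin; apply: diam_subset; apply: subsetUr.
Qed.

Local Notation D := (linfun (@rbd F Z)).
Local Notation C := (suppv F in_core).

(** * Splitting cycles and boundaries along the retraction *)

Section Dimensions.
Variable p : 'End(E).
Hypothesis pP : retraction_along (enum (predC (fun z => rho z == z))) p.

Lemma retract_core c : p c \in C.
Proof.
have [p0 _ _ _ _] := pP; apply/suppvP => t /subsetPn[z zt zN].
by apply: (p0 _ z) => //; rewrite mem_enum; rewrite inE in zN.
Qed.

Lemma retract_id c : c \in C -> p c = c.
Proof.
have [_ pid _ _ _] := pP => /suppvP c0; apply: pid => z t zN zt; apply: c0.
by apply/subsetPn; exists z; rewrite // inE; rewrite mem_enum in zN.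
Qed.

Lemma limg_retract (A : {vspace E}) : (forall c, c \in A -> p c \in A) ->
  (p @: A)%VS = (A :&: C)%VS.
Proof.
move=> pA; apply/vspaceP => c; apply/memv_imgP/memv_capP => [[b bA ->]|[cA cC]].
  by split; [apply: pA | apply: retract_core].
by exists c; rewrite ?retract_id.
Qed.

(** Rank-nullity for [p] on [A], whose image is its part in the core. *)
Lemma dim_retract (A : {vspace E}) : (forall c, c \in A -> p c \in A) ->
  \dim A = (\dim (A :&: lker p) + \dim (A :&: C))%N.
Proof. by move=> pA; rewrite -(limg_ker_dim p A) limg_retract. Qed.

(** This is [z_(N-1)] at level [s]; it will count the extra diagonal bars up to [s]. *)
Definition dim_kercycles N s := \dim (FS N s :&: lker D :&: lker p).

Lemma dim_cycles_split N s :
  \dim (FS N s :&: lker D) = (dim_kercycles N s + \dim (FS N s :&: C :&: lker D))%N.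
Proof.
have [_ _ prbd pF _] := pP.
rewrite dim_retract.
  congr (_ + \dim _)%N; exact: capvAC.
move=> c /memv_capP[cF]; rewrite memv_ker lfunE /= => /eqP bc.
apply/memv_capP; split; first exact: pF.
by rewrite memv_ker lfunE /= prbd bc linear0.
Qed.

(** In the kernel of [p] every cycle bounds in its own sublevel, so bounding in filtration [t] only
    asks for filtration at most [t]; this is where the minimum comes from. *)
Lemma dim_boundaries_split N s t :
  \dim (FS N s :&: D @: FS N.+1 t) =
  (dim_kercycles N (Order.min s t) + \dim (FS N s :&: C :&: D @: (FS N.+1 t :&: C)))%N.
Proof.
have [_ _ prbd pF phom] := pP.
rewrite dim_retract; last first.
  move=> c /memv_capP[cF /memv_imgP[b bF cE]]; apply/memv_capP; split; first exact: pF.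
  by rewrite cE lfunE /= -prbd -(lfunE (@rbd F Z)) memv_img // pF.
have FSm c : (c \in FS N (Order.min s t)) = (c \in FS N s) && (c \in FS N t).
  rewrite -memv_cap suppv_cap; apply/suppvP/suppvP => c0 a aN; apply: c0;
  apply: contra aN; rewrite /sublevel /= le_min; first by case: eqP.
  by case: eqP.
congr (_ + _)%N; congr (\dim _); apply/vspaceP => c.
  rewrite !memv_cap FSm; apply/andP/andP => -[].
    move=> /andP[cs /memv_imgP[b bF cE]] cp; rewrite cp cs /=; split=> //.
    by rewrite cE lfunE /= rbd_filt //= memv_ker lfunE /= rbd_rbd.
  move=> /andP[/andP[cs ct]]; rewrite memv_ker lfunE /= => /eqP bc cp.
  rewrite cs cp; split=> //=; have [h hF hb] := phom _ _ _ ct bc.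
  move: cp hb; rewrite memv_ker => /eqP ->; rewrite subr0 => <-.
  by rewrite -(lfunE (@rbd F Z)) memv_img.
rewrite !memv_cap; apply/andP/andP => -[].
  move=> /andP[cs /memv_imgP[b bF cE]] cC; rewrite cs cC; split=> //.
  (* Applying [p] to a bounding chain moves it into the core and keeps its boundary [c], which [p]
     fixes. *)
  rewrite -(retract_id cC) cE lfunE /= -prbd -(lfunE (@rbd F Z)) memv_img //.
  by rewrite memv_cap pF // retract_core.
move=> /andP[cs cC] /memv_imgP[b /memv_capP[bF bC] cE]; rewrite cs cC cE; split=> //=.
exact: memv_img.
Qed.

(** Rank-nullity for the boundary on the kernel of [p] with [N.+1] vertices: by acyclicity its image
    consists of all the kernel cycles with [N] vertices. *)
Lemma dim_kercycles_rec N s :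
  (dim_kercycles N.+1 s + dim_kercycles N s + #|predI (sublevel N.+1 s) in_core|)%N = #|sublevel N.+1 s|.
Proof.
have [_ _ prbd pF phom] := pP.
rewrite -!(dim_suppv F) -suppv_cap (dim_retract (A := FS N.+1 s)); last exact: pF.
congr (_ + _)%N; rewrite -(limg_ker_dim D).
congr (_ + _)%N; congr (\dim _); first exact: capvAC.
apply/vspaceP => c; apply/idP/memv_imgP.
  move=> /memv_capP[/memv_capP[cF]]; rewrite !memv_ker lfunE /= => /eqP bc /eqP pc.
  (* Subtracting [p h] puts the bounding chain in the kernel; its boundary is still [c] because
     [p c = 0]. *)
  have [h hF hb] := phom _ _ _ cF bc; exists (h - p h).
    rewrite memv_cap memvB ?pF //= memv_ker linearB /= (retract_id (retract_core h)).
    by rewrite subrr.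
  by rewrite lfunE linearB /= prbd hb pc subr0 pc subr0.
move=> [b /memv_capP[bF]]; rewrite memv_ker => /eqP pb ->.
rewrite !memv_cap lfunE /= rbd_filt // !memv_ker lfunE /= rbd_rbd eqxx /=.
by rewrite -prbd pb linear0.
Qed.

(** The empty simplex lies in the core. This starts the recursion on [N]. *)
Lemma dim_kercycles0 s : dim_kercycles 0 s = 0%N.
Proof.
apply/eqP; rewrite dimv_eq0 -subv0; apply/subvP => c.
move=> /memv_capP[/memv_capP[/suppvP cF _]]; rewrite memv_ker memv0 => /eqP <-.
rewrite retract_id //; apply/suppvP => t tC; apply: cF; apply: contra tC.
by rewrite /sublevel /= cards_eq0 => /andP[/eqP -> _]; rewrite /in_core /= sub0set.
Qed.

End Dimensions.

End Retraction.

(** * Chains as elements of the exterior algebra *)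

Section Extension.
Variables (F : fieldType) (V V' : finType) (f : V -> V').
Hypothesis f_inj : injective f.
Hypothesis f_mono : forall a b, (enum_rank (f a) < enum_rank (f b))%N = (enum_rank a < enum_rank b)%N.
Local Notation E := {ffun {set V'} -> F^o}.

Lemma vpos_imset (t : {set V}) v : vpos (f @: t) (f v) = vpos t v.
Proof.
rewrite /vpos -(card_imset _ f_inj); apply: eq_card => w; rewrite !inE.
apply/andP/imsetP => [[/imsetP[u ut ->]]|[u]].
  by rewrite f_mono => uv; exists u; rewrite // inE ut.
by rewrite inE => /andP[ut uv] ->; rewrite imset_f // f_mono.
Qed.

(** Push-forward of chains along [f]; by injectivity the sum has at most one term. It is used for
    the inclusion of [X] in [Z] and for identity maps. *)
Definition ext k (c : chain F V k) : E :=
  [ffun t : {set V'} => \sum_(s : simplex V k | f @: val s == t) c s].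

Lemma ext_is_linear k : linear (@ext k).
Proof.
move=> a c c'; apply/ffunP => t; rewrite !ffunE scaler_sumr -big_split /=.
by apply: eq_bigr => s _; rewrite !ffunE.
Qed.
HB.instance Definition _ k := GRing.isLinear.Build F (chain F V k) E _ (@ext k) (@ext_is_linear k).

Lemma extE k (c : chain F V k) (s : simplex V k) : ext c (f @: val s) = c s.
Proof.
rewrite ffunE (big_pred1 s) // => s'.
by rewrite (inj_eq (imset_inj f_inj)) (inj_eq val_inj).
Qed.

Lemma ext_out k (c : chain F V k) t :
  (forall s : simplex V k, f @: val s != t) -> ext c t = 0.
Proof. by move=> tN; rewrite ffunE big_pred0 // => s; apply/negbTE. Qed.

Lemma ext_inj k : injective (@ext k).
Proof. by move=> c c' /ffunP cc'; apply/ffunP => s; rewrite -!extE cc'. Qed.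

Lemma lker_ext k : lker (linfun (@ext k)) == 0%VS.
Proof. by apply/lker0P => c c'; rewrite !lfunE; apply: ext_inj. Qed.

Lemma ext_nz k (c : chain F V k) t : ext c t != 0 -> exists s : simplex V k, f @: val s = t.
Proof.
have [/existsP[s /eqP <-] _|] := boolP [exists s : simplex V k, f @: val s == t].
  by exists s.
by rewrite negb_exists => /forallP /ext_out ->; rewrite eqxx.
Qed.

(** [f] preserves the vertex order, hence all signs. A facet of the image of a simplex is again such
    an image, so nothing is lost outside the image. *)
Lemma ext_boundary k (c : chain F V k.+1) : ext (boundary F V k c) = rbd (ext c).
Proof.
rewrite lfunE /=; apply/ffunP => t'.
have [/existsP[t /eqP <-]|] := boolP [exists s : simplex V k, f @: val s == t'].
  rewrite extE ffunE [RHS]ffunE imset_eq0 -cards_eq0 (eqP (valP t)) /= bdE.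
  under eq_bigr do rewrite /incidence mulr_sumr.
  rewrite (exchange_big_dep xpredT) //=.
  (* The simplices having [t] as a facet correspond to the vertices outside [t]. *)
  transitivity (\sum_(v in ~: val t) vsgn F (f v) (f @: val t) * ext c (f v |: f @: val t)).
    rewrite [RHS]big_mkcond; apply: eq_bigr => v _; rewrite inE.
    have [vt|vt] /= := boolP (v \in val t).
      by apply: big1 => s /andP[_ /eqP st]; move: vt; rewrite -[val t]st !inE eqxx.
    have tv : #|v |: val t| == k.+2 by rewrite cardsU1 vt (eqP (valP t)).
    rewrite (big_pred1 (Sub (v |: val t) tv)) => [|s] /=.
      rewrite -imsetU1 (extE c (Sub (v |: val t) tv)) /vsgn vpos_imset mulrC.
      by rewrite vposU1.
    rewrite -[RHS]val_eqE /=; apply/andP/eqP => [[vs /eqP <-]|->]; first by rewrite setD1K.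
    by rewrite setU1K // setU11.
  rewrite [RHS](bigID (mem (f @: [set: V]))) /= [X in _ = _ + X]big1 ?addr0; last first.
    move=> v' /andP[_ v'N]; apply/eqP; rewrite mulf_eq0; apply/orP; right.
    apply/eqP/ext_out => s; apply: contra v'N => /eqP/setP/(_ v').
    by rewrite !inE eqxx => /imsetP[u _ ->]; rewrite imset_f // inE.
  rewrite (eq_bigl (fun v' => v' \in f @: (~: val t))) => [|v'].
    by rewrite big_imset //= => u v _ _; apply: f_inj.
  apply/andP/imsetP => [[tN /imsetP[v _ v'E]]|[v vt ->]].
    exists v => //; rewrite inE; apply: contra tN => vt; rewrite v'E; exact: imset_f.
  by rewrite (mem_imset _ _ f_inj) -in_setC vt imset_f // inE.
rewrite negb_exists => /forallP tN; rewrite ext_out // ffunE; case: eqP => // t0.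
rewrite bdE big1 // => v' v't; apply/eqP; rewrite mulf_eq0; apply/orP; right.
apply: contraT => /ext_nz [s sE].
have /imsetP[v vs v'E] : v' \in f @: val s by rewrite sE setU11.
have sv : #|val s :\ v| == k.+1.
  by have := valP s; rewrite (cardsD1 v) vs eqSS.
have /eqP[] := tN (Sub (val s :\ v) sv).
have fvN : f v \notin f @: (val s :\ v) by rewrite (mem_imset _ _ f_inj) !inE eqxx.
by rewrite /= -(setU1K fvN) -imsetU1 setD1K // sE -v'E setU1K.
Qed.

(** The boundary could only land on the empty set, which [rbd] ignores; this matches [cycles] in
    degree 0. *)
Lemma rbd_ext0 (c : chain F V 0) : rbd (ext c) = 0.
Proof.
apply/ffunP => t; rewrite !ffunE; case: eqP => // /eqP t0.
rewrite bdE big1 // => v vt; apply/eqP; rewrite mulf_eq0; apply/orP; right.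
apply: contraT => /ext_nz [s sE]; have := eqP (valP s).
by rewrite -(card_imset _ f_inj) sE cardsU1 vt => -[] /eqP; rewrite cards_eq0 (negbTE t0).
Qed.

Lemma mem_cycles k (c : chain F V k) : (c \in cycles F V k) = (rbd (ext c) == 0).
Proof.
case: k c => [|k] c; first by rewrite rbd_ext0 eqxx memvf.
rewrite /cycles memv_ker -ext_boundary -[in RHS](linear0 (@ext k)).
by rewrite (inj_eq (@ext_inj k)).
Qed.

End Extension.

Section ExtensionFiltration.
Variables (F : fieldType) (R : realType) (X Z : finPMetric R) (f : X -> Z).
Hypothesis f_inj : injective f.
Hypothesis f_mono : forall a b, (enum_rank (f a) < enum_rank (f b))%N = (enum_rank a < enum_rank b)%N.
Hypothesis f_dist : forall a b, pdist (f a) (f b) = pdist a b.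

Definition sublevel_simplices (Y : finPMetric R) k (s : \bar R) : pred (simplex Y k) :=
  [pred t : simplex Y k | ((diam (val t))%:E <= s)%E].

Definition in_image : pred {set Z} := [pred t : {set Z} | t \subset f @: [set: X]].

Local Notation CF k s := (suppv F (@sublevel_simplices X k s)).
Local Notation G N s := (suppv F (predI (@sublevel R Z N s) in_image)).
Local Notation Ext k := (linfun (@ext F X Z f k)).

Lemma limg_ext_suppv k s : (Ext k @: CF k s)%VS = G k.+1 s.
Proof.
apply/vspaceP => e; apply/memv_imgP/suppvP => [[c /suppvP c0 ->] t tN|e0].
  rewrite lfunE /=; apply: contraNeq tN => enz; have [u uE] := ext_nz enz.
  move: enz; rewrite -uE extE // => cu; rewrite /sublevel /in_image /=.
  rewrite (card_imset _ f_inj) (valP u) diam_imset // imsetS ?subsetT //= andbT.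
  by apply: contraNT cu => /c0 ->.
exists [ffun u : simplex X k => e (f @: val u)].
  apply/suppvP => u uN; rewrite ffunE e0 //; apply: contra uN.
  by rewrite /sublevel /= diam_imset // => /andP[/andP[]].
apply/ffunP => t; rewrite lfunE /=.
have [/existsP[u /eqP <-]|] := boolP [exists u : simplex X k, f @: val u == t].
  by rewrite extE // ffunE.
rewrite negb_exists => /forallP tN; rewrite ext_out // e0 //.
rewrite /sublevel /in_image /= andbC negb_and -implybE; apply/implyP => tI.
have tE : f @: (f @^-1: t) = t.
  apply/setP => z; apply/imsetP/idP => [[a]|zt]; first by rewrite inE => ? ->.
  have /imsetP[a _ zE] := fintype.subsetP tI z zt.
  by exists a; rewrite // inE -zE.
rewrite negb_and; apply/orP; left; apply/negP => tk.
have uk : #|f @^-1: t| == k.+1 by rewrite -(card_imset _ f_inj) tE.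
by have := tN (exist (fun u : {set X} => #|u| == k.+1) _ uk); rewrite /= tE eqxx.
Qed.

Lemma dim_limg_ext k (U : {vspace chain F X k}) : \dim (Ext k @: U) = \dim U.
Proof. by apply: limg_dim_eq; rewrite (eqP (lker_ext F f_inj k)) capv0. Qed.

Lemma dim_cycles_ext k s :
  \dim (CF k s :&: cycles F X k) = \dim (G k.+1 s :&: lker (linfun (@rbd F Z))).
Proof.
rewrite -dim_limg_ext -limg_ext_suppv; congr (\dim _).
apply/vspaceP => e; apply/memv_imgP/memv_capP => [[c /memv_capP[cF cZ] ->]|].
  split; first exact: memv_img.
  by rewrite memv_ker lfunE /= lfunE /= -(mem_cycles f_inj f_mono).
move=> [/memv_imgP[c cF ->]]; rewrite memv_ker lfunE /= lfunE /=.
rewrite -(mem_cycles f_inj f_mono) => cZ; exists c; last by rewrite lfunE.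
by apply/memv_capP.
Qed.

Lemma dim_boundaries_ext k s t :
  \dim (CF k s :&: boundary F X k @: CF k.+1 t) =
  \dim (G k.+1 s :&: linfun (@rbd F Z) @: G k.+2 t).
Proof.
rewrite -dim_limg_ext (lker0_img_cap _ _ (lker_ext F f_inj k)) -!limg_ext_suppv.
congr (\dim (_ :&: _)); rewrite -!limg_comp; congr (_ @: _)%VS.
apply/lfunP => c; rewrite !comp_lfunE !lfunE /= -(ext_boundary f_inj f_mono).
by rewrite [in RHS]lfunE.
Qed.

End ExtensionFiltration.

(** * Existence of adapted bases *)

Section Pivots.
Variables (F : fieldType) (T : finType) (rk : T -> nat).
Hypothesis rk_inj : injective rk.
Local Notation E := {ffun T -> F^o}.
Implicit Types (c : E) (t : T).

(** The successor reserves height 0 for the zero vector. *)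
Definition height c : nat := \max_(t | c t != 0) (rk t).+1.

Definition leads c t : bool := (c t != 0) && (height c == (rk t).+1).

Definition lead c : option T := [pick t | leads c t].

Lemma height_le c n : reflect (forall t, c t != 0 -> (rk t < n)%N) (height c <= n)%N.
Proof. exact: bigmax_leqP. Qed.

Lemma leads_ex c : c != 0 -> exists t, leads c t.
Proof.
move=> cN0; have : (0 < #|[pred t | c t != 0%R]|)%N.
  apply/card_gt0P; have [t ct|c0] := pickP [pred t | c t != 0]; first by exists t.
  case/eqP: cN0; apply/ffunP => t; rewrite ffunE; apply/eqP.
  by have /negbFE := c0 t.
move=> /(eq_bigmax_cond (fun t => (rk t).+1))[t ct ht]; exists t.
by rewrite /leads /height ht eqxx andbT.
Qed.

Lemma leads_uniq c t t' : leads c t -> leads c t' -> t = t'.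
Proof. by move=> /andP[_ /eqP ct] /andP[_]; rewrite ct => /eqP[/rk_inj]. Qed.

Lemma lead_Some c t : leads c t -> lead c = Some t.
Proof.
rewrite /lead; case: pickP => [t' ct' ct|/(_ t) -> //].
by rewrite (leads_uniq ct ct').
Qed.

Lemma lead_SomeP c t : lead c = Some t -> leads c t.
Proof. by rewrite /lead; case: pickP => // t' ct' [<-]. Qed.

Lemma leads_neq0 c t : leads c t -> c != 0.
Proof. by case/andP => ct _; apply: contraNneq ct => ->; rewrite ffunE. Qed.

Lemma lead_None c : lead c = None -> c = 0.
Proof.
move=> c0; apply/eqP; apply: contraT => /leads_ex[t /lead_Some].
by rewrite c0.
Qed.

Lemma height0 : height 0 = 0%N.
Proof. by apply: big_pred0 => t; rewrite ffunE eqxx. Qed.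

Lemma height_eq0 c : height c = 0%N -> c = 0.
Proof.
move=> c0; apply/eqP; apply: contraT => /leads_ex[t /andP[_]].
by rewrite c0.
Qed.

Lemma leads_out c t t' : leads c t -> (rk t < rk t')%N -> c t' = 0.
Proof.
case/andP => _ /eqP ct tt'; apply/eqP; apply: contraT => ct'.
have /height_le/(_ _ ct') := leqnn (height c).
by rewrite ct ltnS leqNgt tt'.
Qed.

Lemma leadsI c t : c t != 0 -> (forall t', (rk t < rk t')%N -> c t' = 0) -> leads c t.
Proof.
move=> ct cout; rewrite /leads ct eqn_leq /=; apply/andP; split.
  apply/height_le => t'; apply: contraNT; rewrite -leqNgt => tt'.
  by rewrite cout.
by have /height_le := leqnn (height c); apply.
Qed.

Lemma height_reduce c c' t : leads c t -> leads c' t ->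
  (height (c - (c t / c' t) *: c')%R < height c)%N.
Proof.
move=> ct c't; have /andP[c't0 _] := c't; have /andP[_ /eqP ->] := ct.
rewrite ltnS; apply/height_le => t'; rewrite !ffunE; apply: contraNT; rewrite -leqNgt => tt'.
have [/rk_inj <-|tt'N] := eqVneq (rk t) (rk t').
  by rewrite [_ *: _]mulfVK // subrr.
have {tt'N}tt' : (rk t < rk t')%N by rewrite ltn_neqAle tt'N.
by rewrite (leads_out ct tt') (leads_out c't tt') scaler0 subrr.
Qed.

(** Pivots are distinct, so the highest one with a nonzero coefficient cannot cancel. Freeness and
    orthogonality of echelon families both follow. *)
Lemma leads_sum (I : finType) (e : I -> E) (l : I -> T) (lam : I -> F) i :
  injective l -> (forall i, leads (e i) (l i)) -> lam i != 0 ->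
  exists i0, [/\ lam i0 != 0, forall j, lam j != 0 -> (rk (l j) <= rk (l i0))%N
               & leads (\sum_j lam j *: e j) (l i0)].
Proof.
move=> l_inj el li.
case: (@arg_maxnP _ i [pred j | lam j != 0] (fun j => rk (l j)) li) => i0 li0 max.
have {max}i0max j : lam j != 0 -> (rk (l j) <= rk (l i0))%N := max j.
exists i0; split=> //.
have sumE t : (\sum_j lam j *: e j) t = \sum_j lam j * e j t.
  by rewrite sum_ffunE; apply: eq_bigr => j _; rewrite ffunE.
apply: leadsI => [|t tt]; rewrite sumE.
  rewrite (bigD1 i0) //= big1 ?addr0 => [|j ji0].
    by apply: mulf_neq0 => //; have /andP[] := el i0.
  have [->|lj] := eqVneq (lam j) 0; first by rewrite mul0r.
  rewrite (leads_out (el j)) ?mulr0 // ltn_neqAle i0max // andbT.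
  by rewrite (inj_eq rk_inj) (inj_eq l_inj).
apply: big1 => j _; have [->|lj] := eqVneq (lam j) 0; first by rewrite mul0r.
by rewrite (leads_out (el j)) ?mulr0 //; apply: leq_ltn_trans tt; apply: i0max.
Qed.

Definition echelon (es : seq E) : bool :=
  (None \notin map lead es) && uniq (map lead es).

Lemma echelon_leads (es : seq E) : echelon es ->
  exists2 l : 'I_(size es) -> T, injective l & forall i : 'I_(size es), leads es`_i (l i).
Proof.
move=> /andP[esN esU].
have /choice[l lP] (i : 'I_(size es)) : exists t, lead es`_i = Some t.
  case ei: (lead es`_i) => [t|]; first by exists t.
  by case/negP: esN; rewrite -ei map_f // mem_nth.
exists l => [i j lij|i]; last exact: lead_SomeP.
have nl (h : 'I_(size es)) : nth None (map lead es) h = Some (l h).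
  by rewrite (nth_map 0) ?lP ?ltn_ord.
by apply/ord_inj/eqP; rewrite -(nth_uniq None _ _ esU) ?size_map ?ltn_ord // !nl lij.
Qed.

Lemma echelon_free (es : seq E) : echelon es -> free es.
Proof.
move=> /echelon_leads[l l_inj lP].
change (free (in_tuple es)); apply/freeP => lam lam0 i; apply/eqP; apply: contraT => li.
have [i0 [_ _ /leads_neq0]] := leads_sum l_inj lP li.
by rewrite lam0 eqxx.
Qed.

(** Gaussian elimination: a vector of [U] is reduced by the member of [es] with the same pivot, and
    its height drops. *)
Lemma echelon_basis (es : seq E) (U : {vspace E}) : echelon es ->
  {subset es <= U} -> (forall c t, c \in U -> leads c t -> Some t \in map lead es) ->
  basis_of U es.
Proof.
move=> esE esU Ues; rewrite /basis_of echelon_free // andbT eqEsubv.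
apply/andP; split; first exact/span_subvP.
apply/subvP => c; have [n] := ubnP (height c); elim: n c => // n IH c cn cU.
have [->|/leads_ex[t ct]] := eqVneq c 0; first exact: mem0v.
have /mapP[e ee /esym/lead_SomeP et] := Ues _ _ cU ct.
rewrite -(subrK ((c t / e t) *: e) c); apply: memvD; last by rewrite memvZ // memv_span.
apply: IH; first exact: leq_trans (height_reduce ct et) _.
by rewrite memvB // memvZ // esU.
Qed.

End Pivots.

Section Reduction.
Variables (F : fieldType) (T T' : finType) (rk : T -> nat) (rk' : T' -> nat).
Hypotheses (rk_inj : injective rk) (rk'_inj : injective rk').
Variable D : 'Hom({ffun T -> F^o}, {ffun T' -> F^o}).
Local Notation E := {ffun T -> F^o}.

(* Minimality of the height makes the pivots of distinct nonzero [D (Y s)] differ. *)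
Lemma reduction : exists Y : T -> E, (forall s, leads rk (Y s) s) /\
  forall s c, leads rk c s -> (height rk' (D (Y s)) <= height rk' (D c))%N.
Proof.
suff /choice[Y YP] s : exists y : E, leads rk y s /\
    forall c, leads rk c s -> (height rk' (D y) <= height rk' (D c))%N.
  by exists Y; split=> s; have [] := YP s.
pose P n := `[< exists2 c, leads rk c s & height rk' (D c) = n >].
have exP : exists n, P n.
  exists (height rk' (D [ffun t => (t == s)%:R])); apply/asboolP; eexists; last by [].
  apply: leadsI => [|t st]; rewrite ffunE ?eqxx ?oner_eq0 //.
  by case: eqP st => // ->; rewrite ltnn.
case: (ex_minnP exP) => n /asboolP[y ys yn] nmin; exists y; split=> // c cs.
by rewrite yn; apply: nmin; apply/asboolP; exists c.
Qed.

(** If two boundaries shared a pivot, subtracting a multiple of the lower column from the higher one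
    would keep the pivot of the latter and lower the height of its boundary, against minimality. *)
Lemma reduction_lead_inj (Y : T -> E) (s1 s2 : T) (t : T') :
  (forall s, leads rk (Y s) s) ->
  (forall s c, leads rk c s -> (height rk' (D (Y s)) <= height rk' (D c))%N) ->
  leads rk' (D (Y s1)) t -> leads rk' (D (Y s2)) t -> s1 = s2.
Proof.
move=> Ys Ymin; wlog s12 : s1 s2 / (rk s1 < rk s2)%N => [H|] t1 t2.
  case: (ltngtP (rk s1) (rk s2)) => [|/H/(_ t2 t1)//|/rk_inj//]; first by move/H; apply.
set a := D (Y s2) t / D (Y s1) t.
have : leads rk (Y s2 - a *: Y s1) s2.
  have /andP[Y2 _] := Ys s2.
  apply: leadsI => [|s s2s]; rewrite !ffunE.
    by rewrite (leads_out (Ys s1)) // scaler0 subr0.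
  rewrite (leads_out (Ys s2)) // (leads_out (Ys s1)) ?scaler0 ?subr0 //.
  exact: ltn_trans s2s.
move=> /Ymin; rewrite linearB linearZ /= leqNgt.
by rewrite (height_reduce rk'_inj t2 t1).
Qed.

(** Column reduction as in persistent homology: the nonzero boundaries of the reduced columns form
    an echelon basis of the image, which is completed pivot by pivot to one of [U]. *)
Lemma reduced_bases (U : {vspace {ffun T' -> F^o}}) : (limg D <= U)%VS ->
  exists (y : seq E) (w : seq {ffun T' -> F^o}),
  [/\ echelon rk y /\ echelon rk' w,
      basis_of fullv y /\ basis_of U w,
      basis_of (lker D) (drop (\dim (limg D)) y),
      basis_of (limg D) (take (\dim (limg D)) w) &
      forall i, (i < \dim (limg D))%N -> D y`_i = w`_i].
Proof.
move=> DU; have [Y [Ys Ymin]] := reduction.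
(* Columns with nonzero boundary come first, so that [take] and [drop] cut at the rank. *)
pose L1 := [seq s <- enum T | D (Y s) != 0]; pose L2 := [seq s <- enum T | D (Y s) == 0].
have memL1 s : (s \in L1) = (D (Y s) != 0) by rewrite mem_filter mem_enum andbT.
have memL2 s : (s \in L2) = (D (Y s) == 0) by rewrite mem_filter mem_enum andbT.
have leadY L : map (lead rk) (map Y L) = map Some L.
  by rewrite -map_comp; apply: eq_map => s /=; apply: lead_Some.
have echY L : uniq L -> echelon rk (map Y L).
  move=> LU; rewrite /echelon leadY map_inj_uniq ?LU ?andbT; last by move=> ? ? [].
  by apply/mapP => -[].
have L12U : uniq (L1 ++ L2).
  rewrite cat_uniq; apply/and3P; split; try exact: filter_uniq (enum_uniq _).
  by apply/hasPn => s; rewrite memL1 memL2 => ->.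
have L12 s : s \in L1 ++ L2.
  by rewrite mem_cat memL1 memL2 orNb.
pose w1 := map D (map Y L1).
have w1E : echelon rk' w1.
  apply/andP; split.
    apply/mapP => -[_ /mapP[_ /mapP[s sL1 ->] ->]] /esym/(lead_None rk'_inj) DY.
    by move: sL1; rewrite memL1 DY eqxx.
  rewrite /w1 -!map_comp map_inj_in_uniq ?(filter_uniq _ (enum_uniq _)) // => s1 s2.
  rewrite memL1 => /(leads_ex rk')[t t1] _ /=.
  rewrite (lead_Some rk'_inj t1) => /esym/lead_SomeP t2.
  exact: (reduction_lead_inj Ys Ymin t1 t2).
have yB : basis_of fullv (map Y (L1 ++ L2)).
  apply: (echelon_basis rk_inj); first exact: echY.
    by move=> c _; apply: memvf.
  by move=> c t _ _; rewrite leadY map_f.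
have w1B : basis_of (limg D) w1.
  rewrite /basis_of (echelon_free rk'_inj w1E) andbT -(span_basis yB) limg_span.
  rewrite !map_cat span_cat -[map D (map Y L1)]/w1 eqEsubv addvSl /= subv_add subvv /=.
  apply/span_subvP => _ /mapP[_ /mapP[s sL2 ->] ->].
  by move: sL2; rewrite memL2 => /eqP ->; apply: mem0v.
have r1 : \dim (limg D) = size w1 by rewrite -(span_basis w1B); apply/eqP/(basis_free w1B).
(* [wz t] is a vector of [U] with pivot [t] whenever one exists. *)
have /choice[wz wzP] (t : T') : exists c, (exists2 c', c' \in U & leads rk' c' t) ->
    c \in U /\ leads rk' c t.
  by have [[c' c'U c't]|N] := pselect (exists2 c', c' \in U & leads rk' c' t);
    [exists c' | exists 0].
(* The pivots of [U] that the boundaries do not reach. *)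
pose M := [seq t <- enum T' | `[< exists2 c', c' \in U & leads rk' c' t >]
                              && (Some t \notin map (lead rk') w1)].
have MP t : t \in M -> wz t \in U /\ leads rk' (wz t) t.
  by rewrite mem_filter => /andP[/andP[/asboolP/wzP]].
have leadM : map (lead rk') (map wz M) = map Some M.
  rewrite -map_comp; apply/eq_in_map => t /MP[_] /=; exact: lead_Some.
have wE : echelon rk' (w1 ++ map wz M).
  have /andP[w1N w1U] := w1E; rewrite /echelon map_cat mem_cat negb_or w1N leadM.
  rewrite cat_uniq w1U map_inj_uniq ?(filter_uniq _ (enum_uniq _)) //; last by move=> ? ? [].
  rewrite andbT /=; apply/andP; split; first by apply/mapP => -[].
  by apply/hasPn => _ /mapP[t tM ->]; move: tM; rewrite mem_filter => /andP[/andP[]].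
exists (map Y (L1 ++ L2)), (w1 ++ map wz M); split; last 1 first.
- move=> i; rewrite r1 => iw; rewrite map_cat !nth_cat iw.
  by move: iw; rewrite size_map => iw; rewrite iw -(nth_map 0 0).
- by split; first exact: echY.
- split; first exact: yB.
  apply: (echelon_basis rk'_inj) => [//|c|c t cU ct].
  + by rewrite mem_cat => /orP[/(basis_mem w1B)/(subvP DU) //|/mapP[t /MP[cU _] -> //]].
  + rewrite map_cat mem_cat leadM; case t1: (_ \in map _ w1) => //=.
    rewrite map_f // mem_filter t1 mem_enum !andbT; apply/asboolP.
    by exists c.
- have -> : drop (\dim (limg D)) (map Y (L1 ++ L2)) = map Y L2.
    by rewrite r1 !size_map map_cat drop_size_cat ?size_map.
  apply: (echelon_basis rk_inj) => [|_ /mapP[s sL2 ->]|c s].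
  + by apply: echY; exact: filter_uniq (enum_uniq _).
  + by rewrite memv_ker -memL2.
  (* If some kernel vector has pivot [s], minimality forces the boundary of [Y s] to have height 0
     as well. *)
  + rewrite memv_ker => /eqP Dc /Ymin; rewrite Dc height0 leqn0 => /eqP/height_eq0 DY.
    by rewrite leadY map_f // memL2 DY eqxx.
- by rewrite r1 take_size_cat.
Qed.

End Reduction.

(** * The barcode as a rank function *)

Section VerboseBarcodeRanks.
Variables (F : fieldType) (R : realType) (X : finPMetric R).

Local Notation CF k s := (suppv F (@sublevel_simplices R X k s)).

Lemma filt_leP k (c : chain F X k) (s : \bar R) : (filt c <= s)%E = (c \in CF k s).
Proof.
apply/bigmax_leP/suppvP => [[_ H] t|H].
  by apply: contraNeq => /H.
by split=> [|t ct]; [exact: leNye | apply: contraNT ct => /H ->].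
Qed.

Lemma limg_boundary_sub k : (limg (boundary F X k) <= cycles F X k)%VS.
Proof.
apply/subvP => _ /memv_imgP[b _ ->].
by rewrite (mem_cycles (f := id)) // ext_boundary // rbd_rbd.
Qed.

(** Ties between equal diameters are broken by the position in a sorted list; a pivot is then a
    simplex of largest diameter. *)
Lemma diam_ranking k : exists2 rk : simplex X k -> nat, injective rk &
  forall s t, (rk s <= rk t)%N -> diam (val s) <= diam (val t).
Proof.
pose le (s t : simplex X k) := diam (val s) <= diam (val t).
have leT : total le by move=> s t; apply: le_total.
have le_tr : transitive le by move=> s t u; apply: le_trans.
pose S := sort le (enum {: simplex X k}).
have inS s : s \in S by rewrite mem_sort mem_enum.
exists (fun s => index s S) => [s t|s t st]; first by apply: index_inj.
have := sorted_leq_nth le_tr (fun s => lexx _) s (sort_sorted leT (enum {: simplex X k})).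
move=> /(_ (index s S) (index t S)); rewrite !inE !index_mem !inS => /(_ isT isT st).
by rewrite !nth_index.
Qed.

Section Orthogonality.
Variables (k : nat) (rk : simplex X k -> nat).
Hypothesis rk_inj : injective rk.
Hypothesis rk_diam : forall s t, (rk s <= rk t)%N -> diam (val s) <= diam (val t).

Lemma filt_leads (c : chain F X k) s : leads rk c s -> filt c = (diam (val s))%:E.
Proof.
move=> cs; have /andP[cs0 _] := cs; apply/eqP; rewrite eq_le; apply/andP; split.
  apply/bigmax_leP; split=> [|t ct]; first exact: leNye.
  rewrite lee_fin; apply: rk_diam; rewrite leqNgt; apply: contra ct => st.
  by rewrite (leads_out cs st).
exact: (le_bigmax_cond _ (fun t : simplex X k => (diam (val t))%:E)).
Qed.

Lemma echelon_orthogonal (es : seq (chain F X k)) : echelon rk es -> Defs.orthogonal es.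
Proof.
move=> /echelon_leads[l l_inj lP] lam.
have [i li|l0] := pickP (fun i => lam i != 0); last first.
  rewrite big1 => [|i _]; last by have /negbFE/eqP -> := l0 i; rewrite scale0r.
  by rewrite [RHS]big_pred0 // /filt big_pred0 // => t; rewrite ffunE eqxx.
have [i0 [li0 i0max /filt_leads ->]] := leads_sum rk_inj l_inj lP li.
apply/eqP; rewrite eq_le; apply/andP; split.
  rewrite -(filt_leads (lP i0)).
  exact: (le_bigmax_cond _ (fun i : 'I_(size es) => filt es`_i)).
apply/bigmax_leP; split=> [|j lj]; first exact: leNye.
by rewrite (filt_leads (lP j)) lee_fin; apply/rk_diam/i0max.
Qed.

End Orthogonality.

Lemma adapted_bases_exist k : exists y w, @adapted_bases F R X k y w.
Proof.
have [rk rk_inj rk_diam] := diam_ranking k.+1.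
have [rk' rk'_inj rk'_diam] := diam_ranking k.
have [y [w [[yE wE] bases kerB imB yw]]] :=
  reduced_bases rk_inj rk'_inj (limg_boundary_sub k).
exists y, w; split=> //.
by split; [exact: (echelon_orthogonal rk_inj) | exact: (echelon_orthogonal rk'_inj)].
Qed.

(** The number of bars [(a, b)] with [a <= s] and [b <= t]. For [t = +oo] the infinite bars count as
    well, so all cycles are taken and not just boundaries. *)
Definition rank_function k (s t : \bar R) : nat :=
  if t == +oo%E then \dim (CF k s :&: cycles F X k)
  else \dim (CF k s :&: boundary F X k @: CF k.+1 t).

Lemma orthogonal_filt k (es : seq (chain F X k)) (lam : 'I_(size es) -> F) s :
  Defs.orthogonal es -> \sum_i lam i *: es`_i \in CF k s ->
  forall i, lam i != 0 -> (filt es`_i <= s)%E.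
Proof. by move=> eo; rewrite -filt_leP eo => /bigmax_leP[_ H] i; apply: H. Qed.

Lemma count_iota (P : pred nat) n : count P (iota 0 n) = #|[pred i : 'I_n | P i]|.
Proof.
rewrite -sum1_count -sum1_card -(big_mkord P (fun=> 1%N)) /index_iota subn0.
by [].
Qed.

(** Orthogonality turns a filtration bound on a chain into bounds on the basis vectors it involves,
    so in adapted bases the space in question is a coordinate subspace. *)
Lemma count_bars k (y : seq (chain F X k.+1)) (w : seq (chain F X k)) s t :
  adapted_bases y w ->
  count (fun b => (b.1 <= s)%E && (b.2 <= t)%E) (bars y w) = rank_function k s t.
Proof.
case=> [[yo wo] [yB wB] kerB imB yw].
rewrite (permP (perm_eq_seq_mset _)) count_map /rank_function.
set r := \dim (limg (boundary F X k)) in kerB imB yw *.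
have szw : size (take r w) = r.
  by rewrite -(eqP (basis_free imB)) (span_basis imB).
have rw : (r <= size w)%N by rewrite -szw size_take_min geq_minr.
have [tE|tN] := eqVneq t +oo%E.
  rewrite count_iota.
  apply/esym/(dim_coords (e := fun i : 'I_(size w) => w`_i)) => [lam|v].
    have /freeP fr : free (in_tuple w) := basis_free wB.
    exact: fr.
  split=> [/memv_capP[vF vZ]|[lam -> lam0]].
    have vE := coord_basis (X := in_tuple w) wB vZ.
    exists (fun i => coord (in_tuple w) i v) => // i; apply: contraNeq => ci.
    rewrite /= tE leey andbT; rewrite vE in vF; exact: (orthogonal_filt wo vF ci).
  apply/memv_capP; split; apply: memv_suml => i _.
    have [->|li] := eqVneq (lam i) 0; first by rewrite scale0r mem0v.
    rewrite memvZ // -filt_leP; have := contra_neqT (lam0 i) li.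
    by move=> /= /andP[].
  by rewrite memvZ // (basis_mem wB) // mem_nth.
(* For [t] other than [+oo], the bars of index at least [r] are infinite and drop out. *)
have cE : count (fun i => (filt w`_i <= s)%E && ((if (i < r)%N then filt y`_i else +oo%E) <= t)%E)
     (iota 0 (size w)) = #|[pred i : 'I_r | (filt w`_i <= s)%E && (filt y`_i <= t)%E]|.
  rewrite -(subnKC rw) iotaD count_cat add0n.
  rewrite [X in (_ + X)%N](_ : _ = 0%N) ?addn0.
    rewrite -(count_iota (fun i => (filt w`_i <= s)%E && (filt y`_i <= t)%E)).
    by apply: eq_in_count => i; rewrite mem_iota add0n /= => ->.
  apply/eqP; rewrite -leqn0 leqNgt -has_count; apply/hasPn => i.
  by rewrite mem_iota => /andP[ri _]; rewrite ltnNge ri leye_eq (negbTE tN) andbF.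
rewrite [LHS]cE {cE}.
have nthw (i : 'I_r) : w`_i = (take r w)`_i by rewrite nth_take.
apply/esym/(dim_coords (e := fun i : 'I_r => w`_i)) => [lam|v].
  have szT : size (take r w) == r by apply/eqP.
  have /freeP fr : free (Tuple szT) := basis_free imB.
  move=> lam0; apply: fr; rewrite -[RHS]lam0; by apply: eq_bigr => i _; rewrite nthw.
have szy : (r <= size y)%N.
  by rewrite /r -(span_basis yB) limg_span (leq_trans (dim_span _)) ?size_map.
split=> [/memv_capP[vF /memv_imgP[b bF vE]]|[lam -> lam0]].
  have bE := coord_basis (X := in_tuple y) yB (memvf b).
  pose lam (i : nat) := oapp (fun i => coord (in_tuple y) i b) 0 (insub i).
  have lamE (i : 'I_(size y)) : coord (in_tuple y) i b = lam i by rewrite /lam valK.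
  have lamF i : lam i != 0 -> (filt y`_i <= t)%E.
    rewrite /lam; case: insubP => [j _ <-|_]; last by rewrite eqxx.
    by rewrite /= => cj; rewrite bE in bF; apply: (orthogonal_filt yo bF cj).
  have vE' : v = \sum_(i < r) lam i *: w`_i.
    rewrite vE bE linear_sum /=.
    transitivity (\sum_(i < size y) lam i *: boundary F X k y`_i).
      by apply: eq_bigr => i _; rewrite linearZ lamE.
    rewrite -(big_mkord xpredT (fun i => lam i *: boundary F X k y`_i)).
    rewrite (big_cat_nat _ (n := r)) //= [X in _ + X]big_nat_cond.
    rewrite [X in _ + X]big1 ?addr0 => [|i /andP[/andP[ri iy] _]].
      by rewrite big_mkord; apply: eq_bigr => i _; rewrite yw.
    have : y`_i \in lker (boundary F X k).
      apply: (basis_mem kerB); rewrite -(subnKC ri) -nth_drop mem_nth //.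
      by rewrite size_drop ltn_sub2r // (leq_ltn_trans ri).
    by rewrite memv_ker => /eqP ->; rewrite scaler0.
  exists (fun i : 'I_r => lam i) => // i /=; apply: contraNeq => li; rewrite lamF // andbT.
  (* Orthogonality is given for all of [w], so the coefficients are padded with zeros beyond [r]. *)
  pose mu (j : 'I_(size w)) := if (j < r)%N then lam j else 0.
  have muE : \sum_j mu j *: w`_j \in CF k s.
    suff -> : \sum_j mu j *: w`_j = v by [].
    rewrite vE' (big_ord_widen _ (fun i => lam i *: w`_i) rw) [RHS]big_mkcond /=.
    by apply: eq_bigr => j _; rewrite /mu; case: ifP => //; rewrite scale0r.
  have := orthogonal_filt wo muE (i := widen_ord rw i).
  by rewrite /mu /= ltn_ord; apply.
have lamF i : lam i != 0 -> (filt w`_i <= s)%E && (filt y`_i <= t)%E.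
  by move=> li; have := contra_neqT (lam0 i) li.
apply/memv_capP; split.
  apply: memv_suml => i _; have [->|/lamF/andP[wi _]] := eqVneq (lam i) 0.
    by rewrite scale0r mem0v.
  by rewrite memvZ // -filt_leP.
apply/memv_imgP; exists (\sum_i lam i *: y`_i).
  apply: memv_suml => i _; have [->|/lamF/andP[_ yi]] := eqVneq (lam i) 0.
    by rewrite scale0r mem0v.
  by rewrite memvZ // -filt_leP.
by rewrite linear_sum; apply: eq_bigr => i _; rewrite linearZ /= yw.
Qed.

(** Adapted bases exist, so [xget] selects a genuine barcode, to which [count_bars] applies whatever
    the bases behind it. *)
Lemma count_verbose_barcode k s t :
  count (fun b => (b.1 <= s)%E && (b.2 <= t)%E) (verbose_barcode F X k)
  = rank_function k s t.
Proof.
have [y [w yw]] := adapted_bases_exist k.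
have : @is_verbose_barcode F R X k (verbose_barcode F X k).
  by apply: (@classical_sets.xgetPex _ mset0); exists (bars y w), y, w.
by move=> [y' [w' [yw' ->]]]; apply: count_bars.
Qed.

End VerboseBarcodeRanks.

(** * Generating polynomial of the multiplicities *)

Section Multiplicities.
Local Notation P := {poly int}.

Lemma coef_binom (n i : nat) : (((1 + 'X) ^+ n : P)`_i = 'C(n, i)%:Z)%R.
Proof.
rewrite exprDn coef_sum.
under eq_bigr do rewrite expr1n mul1r coefMn coefXn.
have [ni|ni] := leqP n.+1 i.
  rewrite bin_small // big1 // => j _; case: eqP => [ij|_]; last by rewrite mul0rn.
  by move: ni; rewrite ij ltnNge -ltnS ltn_ord.
rewrite (bigD1 (Ordinal ni)) //= eqxx big1 ?addr0 -?natz // => j ji.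
by case: eqP => [ij|_]; [case/eqP: ji; apply/val_inj | rewrite mul0rn].
Qed.

(** Generating polynomial, by size, of the nonempty subsets of an [n]-element set. *)
Definition nebinom (n : nat) : P := (1 + 'X) ^+ n - 1.

Lemma coef_nebinom n i : (nebinom n)`_i = if i == 0%N then 0 else 'C(n, i)%:Z.
Proof.
rewrite coefB coef_binom coef1; case: eqP => [->|_]; last by rewrite subr0.
by rewrite bin0 subrr.
Qed.

(** Only exponents up to [K] matter, so each factor is truncated and the product expanded over a
    finite type of exponents, as in [mu]. *)
Lemma coef_prod_le q (g : 'I_q -> P) K i : (i <= K)%N ->
  (\prod_j g j)`_i =
  \sum_(w : {ffun 'I_q -> 'I_K.+1} | (\sum_j w j == i)%N) \prod_j (g j)`_(w j).
Proof.
move=> iK; pose tr (p : P) : P := \sum_(w < K.+1) p`_w *: 'X^w.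
have coef_tr p l : (l <= K)%N -> (tr p)`_l = p`_l.
  rewrite -ltnS => lK; rewrite coef_sum (bigD1 (Ordinal lK)) //= coefZ coefXn eqxx mulr1.
  rewrite big1 ?addr0 // => j jl; rewrite coefZ coefXn.
  by case: eqP => [lj|]; rewrite ?mulr0 //; case/eqP: jl; apply/val_inj.
have -> : (\prod_j g j)`_i = (\prod_j tr (g j))`_i.
  elim/big_ind2: _ i iK => // [p p' s s' pp' ss' i iK|j _ i iK]; last by rewrite coef_tr.
  rewrite !coefM.
  apply: eq_bigr => j _; rewrite pp' ?ss' //; first exact: leq_trans (leq_subr _ _) iK.
  by apply: leq_trans iK; rewrite -ltnS.
rewrite /tr bigA_distr_bigA coef_sum [RHS]big_mkcond; apply: eq_bigr => w _ /=.
rewrite scaler_prod coefZ prodrXr coefXn eq_sym.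
by case: eqP => _; rewrite ?mulr1 ?mulr0.
Qed.

(** Generating polynomial of the [q]-th summand of [mu]: the positions after [q] contribute one
    each, whence the power of ['X]. *)
Definition mu_term (ms : seq nat) (q : nat) : P :=
  'X^(size ms - q) *
  \prod_(j < q) (if j.+1 == q then nebinom (nth 0%N ms j) else nebinom (nth 0%N ms j).+1).

Definition mu_poly (ms : seq nat) : P := \sum_(1 <= q < (size ms).+1) mu_term ms q.

Lemma coef_mu_poly ms k : (mu_poly ms)`_k.+1 = (mu k ms)%:Z.
Proof.
rewrite /mu_poly /mu coef_sum -natz natr_sum; apply: eq_big_nat => q /andP[q0 qp].
rewrite coefXnM natr_sum; set a := (size ms - q)%N.
case: ltnP => [ka|ka].
  rewrite big1 // => w /andP[_ /eqP wk].
  by have := leq_addl (\sum_(j < q) w j)%N a; rewrite wk leqNgt ka.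
rewrite (coef_prod_le _ (leq_subr a k.+1)) [RHS]big_mkcondl /=.
apply: eq_big => [w|w _].
  by rewrite -(eqn_add2r a) subnK.
(* [nebinom] has no constant term, which encodes the condition [0 < w j]. *)
case: ifP => [/forallP w0|/negbT]; last first.
  rewrite negb_forall => /existsP[j]; rewrite -eqn0Ngt => /eqP wj.
  by rewrite (bigD1 j) //= wj; case: ifP; rewrite coef_nebinom eqxx mul0r.
rewrite natr_prod; apply: eq_bigr => j _; have := w0 j; rewrite lt0n => /negbTE wj.
by case: ifP; rewrite coef_nebinom wj natz.
Qed.

Lemma mu_poly_nz0 ms : (mu_poly ms)`_0 = 0.
Proof.
rewrite coef_sum big_nat big1 // => q /andP[]; case: q => // q _ _.
rewrite coefXnM; case: ifP => // _; rewrite sub0n -horner_coef0 horner_prod.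
by rewrite (bigD1 ord_max) //= eqxx horner_coef0 coef_nebinom mul0r.
Qed.

(* [(1 + X) ((1 + X)^m - 1) = ((1 + X)^(m+1) - 1) - X] makes the sum over q telescope. *)
Lemma mu_poly_telescope ms :
  (1 + 'X) * mu_poly ms = \prod_(m <- ms) nebinom m.+1 - 'X^(size ms).
Proof.
pose T q : P := 'X^(size ms - q) * \prod_(j < q) nebinom (nth 0%N ms j).+1.
have -> : \prod_(m <- ms) nebinom m.+1 - 'X^(size ms) = T (size ms) - T 0%N.
  rewrite /T subnn expr0 mul1r subn0 big_ord0 mulr1; congr (_ - _).
  by rewrite (big_nth 0%N) big_mkord.
rewrite /mu_poly big_add1 /= mulr_sumr -telescope_sumr //; apply: eq_big_nat => q /andP[_ qp].
rewrite /T /mu_term !big_ord_recr /= eqxx.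
under eq_bigr => j _ do rewrite eqSS (ltn_eqF (ltn_ord j)).
rewrite -[(size ms - q)%N]prednK ?subn_gt0 // -subnS exprS /nebinom exprS.
set p := \prod_(i < q) _; move: ('X^_) ((1 + 'X) ^+ _) => u v; ring.
Qed.

Lemma mu_recE ms k :
  ((mu k.+1 ms + mu k ms)%N%:Z = (\prod_(m <- ms) nebinom m.+1)`_k.+2 - (k.+2 == size ms)%:Z)%R.
Proof.
have := congr1 (fun p : P => p`_k.+2) (mu_poly_telescope ms).
by rewrite mulrDl mul1r coefD coefXM coefB coefXn !coef_mu_poly natz.
Qed.

Lemma mu0E ms :
  ((mu 0 ms)%:Z = (\prod_(m <- ms) nebinom m.+1)`_1 - (1%N == size ms)%:Z)%R.
Proof.
have := congr1 (fun p : P => p`_1) (mu_poly_telescope ms).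
by rewrite mulrDl mul1r coefD coefXM coefB coefXn coef_mu_poly mu_poly_nz0 addr0 natz.
Qed.

Lemma mu_singleton k m : mu k [:: m] = 'C(m, k.+1).
Proof.
apply/eqP; rewrite -eqz_nat -coef_mu_poly /mu_poly big_nat1 /mu_term subnn expr0 mul1r.
by rewrite big_ord1 /= coef_nebinom.
Qed.

Lemma prod_addr1_subsets (A : comNzRingType) (I : finType) (S : {set I}) (f : I -> A) :
  \prod_(i in S) (1 + f i) = \sum_(J : {set I} | J \subset S) \prod_(i in J) f i.
Proof.
pose g i := if i \in S then f i else 0.
transitivity (\prod_i (g i + 1)).
  rewrite big_mkcond; apply: eq_bigr => i _; rewrite /g addrC.
  by case: ifP => //; rewrite add0r.
rewrite bigA_distr [RHS]big_mkcond; apply: eq_bigr => J _.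
case: ifP => [/fintype.subsetP JS|/negbT/subsetPn[i iJ iS]].
  rewrite [RHS]big_mkcond; apply: eq_bigr => i _.
  by case: ifP => // /JS iS; rewrite /g iS.
by rewrite (bigD1 i) //= iJ /g (negbTE iS) mul0r.
Qed.

Lemma sum_subsets_exp (I : finType) (S : {set I}) :
  \sum_(J : {set I} | J \subset S) 'X^#|J| = (1 + 'X) ^+ #|S| :> P.
Proof.
rewrite -prodr_const prod_addr1_subsets.
by apply: eq_bigr => J _; rewrite prodr_const.
Qed.

(** A set with image [A] is a choice of a nonempty subset in each fiber over [A]. Summed over all
    [B] inside [A], both sides count the subsets of the preimage of [A]; induction on the size of
    [A] removes the proper [B]. *)
Lemma sum_fibers (V W : finType) (g : V -> W) (A : {set W}) :
  \sum_(t : {set V} | g @: t == A) 'X^#|t| =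
  \prod_(a in A) nebinom #|g @^-1: [set a]|.
Proof.
have [n] := ubnP #|A|; elim: n A => // n IH A; rewrite ltnS => An.
have : \sum_(B : {set W} | B \subset A) \sum_(t : {set V} | g @: t == B) 'X^#|t| =
       \sum_(B : {set W} | B \subset A) \prod_(a in B) nebinom #|g @^-1: [set a]|.
  rewrite -prod_addr1_subsets.
  have -> : \prod_(a in A) (1 + nebinom #|g @^-1: [set a]|) = (1 + 'X) ^+ #|g @^-1: A|.
    rewrite -sum1_card (partition_big g (mem A)) /= => [|v]; last by rewrite inE.
    rewrite expr_sum; apply: eq_bigr => a aA; rewrite /nebinom addrC subrK sum1dep_card.
    congr (_ ^+ _); apply: eq_card => v; rewrite !inE.
    by case: eqP => [->|]; rewrite ?aA ?andbF.
  rewrite -sum_subsets_exp (exchange_big_dep xpredT) //= [RHS]big_mkcond.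
  apply: eq_bigr => t _; rewrite -sub_imset_pre.
  case: ifP => tA.
    by rewrite (big_pred1 (g @: t)) // => B /=; rewrite eq_sym andb_idl // => /eqP ->.
  by rewrite big_pred0 // => B; apply/andP => -[BA /eqP tB]; rewrite tB BA in tA.
rewrite (bigD1 A) //= [RHS](bigD1 A) //=.
rewrite [in X in X -> _](eq_bigr (fun B : {set W} => \prod_(a in B) nebinom #|g @^-1: [set a]|)).
  by move/addIr.
by move=> B; rewrite andbC -properEneq => BA; apply: IH; apply: leq_trans (proper_card BA) An.
Qed.

Lemma coef_sum_fibers (V W : finType) (g : V -> W) (A : {set W}) N :
  (\prod_(a in A) nebinom #|g @^-1: [set a]|)`_N =
  #|[pred t : {set V} | (g @: t == A) && (#|t| == N)]|%:Z.
Proof.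
rewrite -sum_fibers coef_sum -sum1_card -natz natr_sum big_mkcondr /=.
by apply: eq_bigr => t _; rewrite coefXn eq_sym; case: ifP.
Qed.

End Multiplicities.

(** * Comparing the barcodes *)

Section DominanceCounts.
Variables (d : Order.disp_t) (T : orderType d).
Implicit Types (p q : T * T) (s : seq (T * T)).

Let dom p q : bool := ((q.1 <= p.1) && (q.2 <= p.2))%O.

(** A lexicographically least pair is minimal for the product order. *)
Lemma dom_minimal s : s != [::] ->
  exists2 p, p \in s & forall q, q \in s -> dom p q -> q = p.
Proof.
move=> sN; suff [p ps pmin] : exists2 p, p \in s &
    forall q, q \in s -> ((p.1 < q.1) || (p.1 == q.1) && (p.2 <= q.2))%O.
  exists p => // q /pmin pq /andP[q1 q2]; apply/eqP; rewrite -pair_eqE /= /pair_eq.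
  move: pq; rewrite ltNge q1 /= => /andP[/eqP -> p2].
  by rewrite eqxx eq_le q2 p2.
elim: s sN => // a s IH _; have [->|/IH[p ps pmin]] := eqVneq s [::].
  by exists a; rewrite ?mem_head // => q; rewrite inE => /eqP ->; rewrite eqxx lexx orbT.
case: (boolP ((a.1 < p.1) || (a.1 == p.1) && (a.2 <= p.2))%O) => ap.
  exists a; rewrite ?mem_head // => q; rewrite inE => /orP[/eqP ->|/pmin].
    by rewrite eqxx lexx orbT.
  case/orP: ap => [ap|/andP[/eqP -> ap]].
    case/orP => [pq|/andP[/eqP <- _]]; last by rewrite ap.
    by rewrite (lt_trans ap pq).
  by case/orP => [->//|/andP[-> pq]]; rewrite (le_trans ap pq) orbT.
exists p; first by rewrite inE ps orbT.
move=> q; rewrite inE => /orP[/eqP ->|/pmin //].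
move: ap; rewrite negb_or negb_and -leNgt -ltNge le_eqVlt eq_sym.
by case: eqP => [_ /= /ltW ->|_ /= /andP[->]]; rewrite ?orbT.
Qed.

(** A minimal pair of [s] also occurs in [s']; after removing it from both, the counts still
    agree. *)
Lemma perm_eq_dominance s s' :
  (forall p, count (dom p) s = count (dom p) s') -> perm_eq s s'.
Proof.
elim: {s}(size s) {-2}s (erefl (size s)) s' => [|n IH] s sn s' H.
  move/size0nil: sn H => -> H; case: s' H => // q s' /(_ q) /=.
  by rewrite /dom !lexx.
have [|p ps pmin] := @dom_minimal s; first by rewrite -size_eq0 sn.
(* [s'] has some [q] below [p], and then [s] has some [r] below [q]; minimality forces [r = p],
   hence [q = p]. *)
have ps' : p \in s'.
  have /hasP[q qs' pq] : has (dom p) s'.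
    by rewrite has_count -H -has_count; apply/hasP; exists p; rewrite // /dom !lexx.
  have /hasP[r rs qr] : has (dom q) s.
    by rewrite has_count H -has_count; apply/hasP; exists q; rewrite // /dom !lexx.
  suff rp : r = p.
    have -> // : p = q; rewrite -rp; apply/eqP; rewrite -pair_eqE /pair_eq !eq_le.
    move: pq qr; rewrite /dom rp => /andP[-> ->] /andP[-> ->] //.
  apply: pmin => //; move: pq qr => /andP[q1 q2] /andP[r1 r2].
  by rewrite /dom (le_trans r1 q1) (le_trans r2 q2).
rewrite (perm_trans (perm_to_rem ps)) // perm_sym (perm_trans (perm_to_rem ps')) //.
rewrite perm_cons perm_sym; apply: IH => [|q].
  by rewrite size_rem // sn.
have := H q; rewrite (permP (perm_to_rem ps)) (permP (perm_to_rem ps')) /=.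
exact: addnI.
Qed.

End DominanceCounts.

Lemma count_msetD (K : choiceType) (P : pred K) (A B : {mset K}%mset) :
  count P (A `+` B)%mset = (count P A + count P B)%N.
Proof.
rewrite -count_cat; apply/permP/allP => a _ /=.
by rewrite count_cat !count_mem_mset msetE2.
Qed.

Lemma count_msetn (K : choiceType) (P : pred K) c (a : K) : count P (msetn c a) = (P a * c)%N.
Proof. by rewrite enum_msetn count_nseq. Qed.

(** A sum type is enumerated with its left summand first and in order, so the inclusion of [X] in
    [Z] preserves orientations. *)
Lemma enum_rank_inl (T1 T2 : finType) (a b : T1) :
  (enum_rank (inl a : T1 + T2)%type < enum_rank (inl b : T1 + T2)%type)%N =
  (enum_rank a < enum_rank b)%N.
Proof.
have rankE (T : finType) (t : T) : enum_rank t = index t (enum T) :> nat.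
  by rewrite -[in RHS](nth_enum_rank t t) index_uniq ?enum_uniq // -cardE.
have inlE (t : T1) : enum_rank (inl t : T1 + T2)%type = index t (enum T1) :> nat.
  rewrite rankE [in LHS]enumT [in LHS]unlock /= /sum_enum index_cat.
  by rewrite (mem_map (@inl_inj _ _)) -!enumT mem_enum inE (index_map (@inl_inj _ _)).
by rewrite !inlE !rankE.
Qed.


(** Every [w j] is at least 1, so the constraint in [mu] forces [size ms <= k.+1]. *)
Lemma mu_large k ms : (k.+1 < size ms)%N -> mu k ms = 0%N.
Proof.
move=> km; rewrite /mu big_nat big1 // => q /andP[_ qp].
rewrite big_pred0 // => w; apply/negbTE; rewrite negb_and -implybE.
apply/implyP => /forallP w0; rewrite neq_ltn; apply/orP; right; apply: leq_trans km _.
rewrite -[X in (X <= _)%N](@subnKC q) // leq_add2r -[X in (X <= _)%N]card_ord -sum1_card.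
exact: leq_sum.
Qed.

Lemma mu_nil k : mu k [::] = 0%N.
Proof. by rewrite /mu big_geq. Qed.

Section SortedTuples.
Variable n : nat.

Lemma sorted_enum_ord (J : {set 'I_n}) : sorted ltn (map val (enum J)).
Proof.
rewrite sorted_map; apply: sorted_filter => [i j l|]; first exact: ltn_trans.
by rewrite -sorted_map -enumT val_enum_ord iota_ltn_sorted.
Qed.

Lemma enum_sorted (I : seq 'I_n) : sorted ltn (map val I) -> enum [set i in I] = I.
Proof.
move=> Is; apply: (inj_map val_inj); apply: (irr_sorted_eq ltn_trans ltnn) => //.
  exact: sorted_enum_ord.
by apply: eq_mem_map => i; rewrite mem_enum inE.
Qed.

(** A strictly increasing tuple is the enumeration of its set of entries. *)
Lemma sum_sorted_tuples p (G : {set 'I_n} -> nat) :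
  (\sum_(I : p.-tuple 'I_n | sorted ltn (map val I)) G [set i in I] =
   \sum_(J : {set 'I_n} | #|J| == p) G J)%N.
Proof.
pose h (I : p.-tuple 'I_n) := [set i in I].
rewrite -[LHS](big_imset (h := h) _ (A := [pred I : p.-tuple 'I_n | sorted ltn (map val I)])).
  apply: eq_bigl => J; apply/imsetP/eqP => [[I Is ->]|Jp].
    rewrite cardE (enum_sorted Is) size_tuple //.
  have Jt : size (enum J) == p by rewrite -cardE Jp.
  exists (Tuple Jt); first exact: sorted_enum_ord.
  by apply/setP => i; rewrite inE /= mem_enum.
move=> I I' Is Is' hI; apply: val_inj.
by rewrite /= -(enum_sorted Is) -(enum_sorted Is') -[[set i in I]]/(h I) hI.
Qed.

End SortedTuples.

(** * Counting the simplices of [Z] by their image in [X] *)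

Section AddCopiesRanks.
Variables (F : fieldType) (R : realType) (X : finPMetric R) (n : nat) (x : 'I_n -> X).
Hypothesis xbij : bijective x.
Variable m : 'I_n -> nat.
Local Notation Z := (add_copies x m).

Definition orig (a : X) : Z := inl a.
Definition proj (z : Z) : X := copies_proj x z.
Definition rho (z : Z) : Z := inl (proj z).

Lemma orig_inj : injective orig. Proof. by move=> a b []. Qed.

Lemma rho_idem z : rho (rho z) = rho z. Proof. by []. Qed.

Lemma rho_dist a b : pdist (rho a) (rho b) = pdist a b. Proof. by []. Qed.

Lemma core_rho : core rho = orig @: [set: X].
Proof.
apply/setP => z; rewrite inE; apply/eqP/imsetP => [<-|[a _ ->] //].
by exists (proj z).
Qed.

Lemma card_fiber i : #|proj @^-1: [set x i]| = (m i).+1.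
Proof.
have -> : proj @^-1: [set x i] =
    orig (x i) |: [set (inr (Tagged (fun j => 'I_(m j)) c) : Z) | c : 'I_(m i)].
  apply/setP => z; rewrite !inE; case: z => [a|[j c]] /=.
    apply/eqP/orP => [->|[/eqP[->]//|/imsetP[]//]].
    by left.
  apply/eqP/idP => [/(bij_inj xbij) ij|/imsetP[c' _ jc]].
    by case: _ / ij c => c; apply: imset_f.
  by have /= -> := congr1 (fun z : Z => if z is inr v then tag v else j) jc.
rewrite cardsU1 card_imset ?card_ord => [|c c' [/eqP]].
  by rewrite (_ : _ \notin _) //; apply/imsetP => -[].
by rewrite eq_Tagged => /eqP.
Qed.

Variable u : \bar R.

Let weight (J : {set 'I_n}) : nat := ((diam (x @: J))%:E <= u)%E.

Let ms (J : {set 'I_n}) : seq nat := map m (enum J).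

Lemma sum_imset_bij (G : {set X} -> nat) :
  (\sum_(A : {set X}) G A = \sum_(J : {set 'I_n}) G (x @: J))%N.
Proof.
have [y xK yK] := xbij; apply: reindex; exists (fun A : {set X} => y @: A) => A _.
  by rewrite -imset_comp (eq_imset (g := id)) ?imset_id // => i /=; rewrite xK.
by rewrite -imset_comp (eq_imset (g := id)) ?imset_id // => i /=; rewrite yK.
Qed.

Lemma card_sublevel N :
  #|sublevel N u : pred {set Z}| =
  (\sum_(J : {set 'I_n}) weight J *
   #|[pred t : {set Z} | (proj @: t == x @: J) && (#|t| == N)]|)%N.
Proof.
pose G (A : {set X}) := (((diam A)%:E <= u)%E *
   #|[pred t : {set Z} | (proj @: t == A) && (#|t| == N)]|)%N.
rewrite -(sum_imset_bij G) -sum1_card.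
rewrite (partition_big (fun t : {set Z} => proj @: t) xpredT) //=.
apply: eq_bigr => A _; rewrite /G -sum1_card big_distrr /= big_mkcond [RHS]big_mkcond.
apply: eq_bigr => t _; rewrite muln1 /sublevel !inE.
have [<-|_] := eqVneq (proj @: t) A; rewrite ?andbF // andbT /=.
by rewrite (diam_imset (f := proj)) //; case: (#|t| == N) => //=; case: ifP.
Qed.

Lemma card_sublevel_core N :
  #|predI (sublevel N u) (in_core rho)| =
  (\sum_(J : {set 'I_n}) weight J * (N == #|J|))%N.
Proof.
pose G (A : {set X}) := (((diam A)%:E <= u)%E * (N == #|A|))%N.
transitivity (\sum_(A : {set X}) G A)%N; last first.
  rewrite sum_imset_bij; apply: eq_bigr => J _.
  by rewrite /G card_imset //; apply: bij_inj.
transitivity #|[set orig @: (A : {set X}) | A in [pred A : {set X} | G A == 1%N]]|.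
  apply: eq_card => t; rewrite !inE /in_core /= core_rho.
  apply/andP/imsetP => [[tN tc]|[A AG ->]].
    have tE : orig @: (orig @^-1: t) = t.
      apply/setP => z; apply/imsetP/idP => [[a]|zt]; first by rewrite inE => ? ->.
      have /imsetP[a _ zE] := fintype.subsetP tc z zt.
      by exists a; rewrite // inE -zE.
    exists (orig @^-1: t); rewrite // inE /G -(card_imset _ orig_inj) tE.
    by rewrite -(diam_imset (f := orig)) // tE; move: tN => /andP[/eqP -> ->]; rewrite eqxx.
  rewrite imsetS ?subsetT //; split=> //; move: AG; rewrite /sublevel /= inE /G.
  rewrite card_imset; last exact: orig_inj.
  by rewrite diam_imset // [N == _]eq_sym; case: (#|A| == N); case: (_ <= _)%E.
rewrite card_imset; last exact: (imset_inj orig_inj).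
rewrite -sum1_card big_mkcond; apply: eq_bigr => A _; rewrite inE /G.
by case: (_ <= _)%E; case: (N == #|A|).
Qed.

Lemma prod_fibers (J : {set 'I_n}) :
  \prod_(a in x @: J) nebinom #|proj @^-1: [set a]| =
  \prod_(l <- ms J) nebinom l.+1.
Proof.
rewrite big_imset /=; last by move=> i j _ _; apply: (bij_inj xbij).
rewrite /ms big_map big_enum /=; apply: eq_bigr => i _.
by rewrite card_fiber.
Qed.

Variable p : 'End({ffun {set Z} -> F^o}).
Hypothesis pP : retraction_along (enum (predC (fun z => rho z == z))) p.

(** Both sides satisfy the same recursion in [N]: [dim_kercycles_rec] on the left, [mu_recE] and
    [mu0E] on the right. *)
Lemma dim_kercycles_mu N : dim_kercycles p N.+1 u = (\sum_(J : {set 'I_n}) weight J * mu N (ms J))%N.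
Proof.
have sz J : size (ms J) = #|J| by rewrite size_map -cardE.
(* Simplices of [Z] minus those of [X], grouped by image; the subtraction is done in [int]. *)
have recE M : (dim_kercycles p M.+1 u + dim_kercycles p M u)%:Z =
    \sum_(J : {set 'I_n}) (weight J)%:Z *
      ((\prod_(l <- ms J) nebinom l.+1)`_M.+1 - (M.+1 == size (ms J))%:Z).
  apply: (addIr (#|predI (sublevel M.+1 u) (in_core rho)|%:Z)).
  rewrite -PoszD (dim_kercycles_rec pP) card_sublevel card_sublevel_core.
  rewrite -!natz !natr_sum -big_split; apply: eq_bigr => J _ /=.
  rewrite !natrM !natz -mulrDr -prod_fibers coef_sum_fibers sz.
  by rewrite subrK.
elim: N => [|N IH]; apply/eqP; rewrite -eqz_nat; apply/eqP.
  have := recE 0%N; rewrite (dim_kercycles0 pP) addn0 => ->.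
  rewrite -natz natr_sum; apply: eq_bigr => J _; rewrite natrM !natz.
  by rewrite -mu0E.
apply: (addIr (dim_kercycles p N.+1 u)%:Z); rewrite -PoszD recE IH.
rewrite -!natz !natr_sum -big_split; apply: eq_bigr => J _ /=.
by rewrite !natrM !natz -mulrDr -PoszD mu_recE.
Qed.

(** Sets of size 0 or above [k.+1] have [mu] equal to 0, which leaves the range of [p] in the
    theorem. *)
Lemma sum_tuples_mu k :
  (\sum_(J : {set 'I_n}) weight J * mu k (ms J))%N =
  (\sum_(1 <= q < k.+2) \sum_(I : q.-tuple 'I_n | sorted ltn (map val I))
     ((diam [set x i | i in I])%:E <= u)%E * mu k (map m I))%N.
Proof.
transitivity (\sum_(1 <= q < k.+2)
    \sum_(J : {set 'I_n} | #|J| == q) weight J * mu k (ms J))%N; last first.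
  apply: eq_bigr => q _.
  rewrite -(sum_sorted_tuples q (fun J => weight J * mu k (ms J))%N).
  apply: eq_bigr => I Is; rewrite /ms (enum_sorted Is) /weight.
  congr (_ * _)%N; congr (nat_of_bool ((diam _)%:E <= u)%E).
  by apply/setP => a; apply/imsetP/imsetP => -[i iI ->]; exists i; rewrite ?inE // in iI *.
rewrite (exchange_big_dep xpredT) //=; apply: eq_bigr => J _.
have [Jk|JkN] := boolP (#|J| \in index_iota 1 k.+2).
  rewrite -big_filter (eq_filter (a2 := pred1 #|J|)) => [|q]; last exact: eq_sym.
  by rewrite filter_pred1_uniq ?iota_uniq // big_seq1.
rewrite big1_seq => [|q /andP[/eqP <-]]; last by rewrite (negbTE JkN).
move: JkN; rewrite mem_index_iota negb_and -!leqNgt leqn0 => /orP[J0|kJ].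
  by rewrite /ms (_ : enum J = [::]) ?mu_nil ?muln0 //; apply/nilP; rewrite /nilp -cardE.
by rewrite mu_large ?muln0 // size_map -cardE.
Qed.

End AddCopiesRanks.

(** * Rank functions of [Z] and [X] *)

Section RankDifference.
Variables (F : fieldType) (R : realType) (X : finPMetric R) (n : nat) (x : 'I_n -> X).
Hypothesis xbij : bijective x.
Variable m : 'I_n -> nat.
Local Notation Z := (add_copies x m).

Variable p : 'End({ffun {set Z} -> F^o}).
Hypothesis pP : retraction_along (enum (predC (fun z => rho z == z))) p.

Lemma rank_function_add_copies k s t :
  rank_function F Z k s t = (rank_function F X k s t + dim_kercycles p k.+1 (Order.min s t))%N.
Proof.
(* Both complexes are placed in the exterior algebra on [Z]: [f = id] gives [Z], and [f = orig]
   gives [X], whose image is the core. *)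
pose G (Y : finPMetric R) (f : Y -> Z) N u := suppv F (predI (sublevel N u) (in_image f)).
have GZ N u : G Z id N u = suppv F (sublevel N u).
  apply: eq_suppv => a; rewrite /= [in_image _ _](_ : _ = true) ?andbT //.
  by apply/fintype.subsetP => z _; rewrite imset_id inE.
have GX N u : G X (@orig R X n x m) N u = (suppv F (sublevel N u) :&: suppv F (in_core (@rho R X n x m)))%VS.
  by rewrite suppv_cap; apply: eq_suppv => a; rewrite /in_core /= core_rho.
have orig_mono (a b : X) : (enum_rank (orig x m a) < enum_rank (orig x m b))%N =
    (enum_rank a < enum_rank b)%N by exact: enum_rank_inl.
rewrite /rank_function; case: eqP => [->|_].
  rewrite (dim_cycles_ext F (f := id) (Z := Z)) // -[suppv _ _]/(G Z id k.+1 s) GZ.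
  rewrite (dim_cycles_split pP) (dim_cycles_ext F (@orig_inj _ _ _ x m) orig_mono) //.
  rewrite -[suppv _ (predI _ (in_image _))]/(G X (@orig R X n x m) k.+1 s) GX.
  by rewrite addnC min_l // leey.
rewrite (dim_boundaries_ext F (f := id) (Z := Z)) //.
rewrite -[suppv _ (predI (sublevel k.+1 s) _)]/(G Z id k.+1 s).
rewrite -[suppv _ (predI (sublevel k.+2 t) _)]/(G Z id k.+2 t) !GZ.
rewrite (dim_boundaries_split pP).
rewrite (dim_boundaries_ext F (@orig_inj _ _ _ x m) orig_mono) //.
rewrite -[suppv _ (predI (sublevel k.+1 s) (in_image _))]/(G X (@orig R X n x m) k.+1 s).
rewrite -[suppv _ (predI (sublevel k.+2 t) (in_image _))]/(G X (@orig R X n x m) k.+2 t) !GX.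
by rewrite addnC.
Qed.

End RankDifference.

Theorem proposition1p4 (F : fieldType) (R : realType) (X : finPMetric R)
    (Xmetric : is_metric X) (n : nat) (x : 'I_n -> X) (xbij : bijective x)
    (m : 'I_n -> nat) (k : nat) :
  verbose_barcode F (add_copies x m) k =
    (verbose_barcode F X k `+`
     \big[msetD/mset0]_(1 <= p < k.+2)
       \big[msetD/mset0]_(I : p.-tuple 'I_n | sorted ltn (map val I))
         msetn (mu k (map m I))
           ((diam [set x i | i in I])%:E, (diam [set x i | i in I])%:E))%mset
  /\ (forall j : 'I_n, mu k (map m [:: j]) = 'C(m j, k.+1)).
Proof.
split=> [|j]; last exact: mu_singleton.
have [p pP] : exists p : 'End({ffun {set add_copies x m} -> F^o}),
    retraction_along (enum (predC (fun z : add_copies x m => rho z == z))) p.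
  by apply: (retraction_along_exists F (rho := @rho R X n x m)) => // z; rewrite mem_enum.
(* The barcodes are equal once they have equally many bars below each [(s, t)]. *)
rewrite -[LHS]seq_mset_id -[RHS]seq_mset_id; apply/eq_seq_msetP/perm_eq_dominance => -[s t].
rewrite count_verbose_barcode (rank_function_add_copies pP) count_msetD.
rewrite count_verbose_barcode; congr (_ + _)%N.
rewrite (dim_kercycles_mu xbij _ pP) sum_tuples_mu.
set P := (P in count P _).
have count0 : count P (mset0 : {mset \bar R * \bar R}%mset) = 0%N by rewrite enum_mset0.
rewrite (big_morph (fun A : {mset \bar R * \bar R}%mset => count P A) (count_msetD P) count0).
apply: eq_bigr => q _.
rewrite (big_morph (fun A : {mset \bar R * \bar R}%mset => count P A) (count_msetD P) count0).
(* A diagonal bar [(d, d)] lies below [(s, t)] exactly when [d] is at most the minimum of [s] and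
   [t]. *)
by apply: eq_bigr => I _; rewrite count_msetn /P /= le_min.
Qed.
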